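(* Let $\mathcal H_1,\mathcal H_2,\mathcal D_S,\mathcal D_2,\mathcal D_{-S},\mathcal D_{-1},\mathcal D_{-2}$ be complex Hilbert spaces and $A,B,C,D_0,D$ operators satisfying assumptions (a)--(c) of the context, and let $\Theta\subset\mathbb C$, the operator matrix $\mathcal A_0$ in $\mathcal H_1\oplus\mathcal H_2$, the family $S(\lambda)$ and the family $S_0(\lambda)$ of operators in $\mathcal H_1$, $\lambda\in\Theta$, be as in the context. For $\lambda\in\Theta$ consider the following condition: $(\ast)_\lambda$: $S(\lambda)\in\mathcal B(\mathcal D_S,\mathcal D_{-S})$, $\operatorname{dom}S_0(\lambda)$ is dense in $\mathcal D_S$, $B(\operatorname{dom}D_0)\subset\mathcal D_{-S}$, and there exists $z\in\mathbb C$ such that $\operatorname{ran}(S_0(\lambda)-z)$ is closed in $\mathcal H_1$ with $\operatorname{coker}(S_0(\lambda)-z)=\{0\}$ and such that there exists an extension $(S_0(\lambda)-z)^\#\subset S_z^\ddagger\in\mathcal B(\mathcal D_{-S},\mathcal D_S)$. (i) If $\Sigma\subset\Theta$ is such that for all $\lambda\in\Sigma$ condition $(\ast)_\lambda$ holds and $\lambda\in\rho(D_0)$, then $$\sigma(\mathcal A_0)\cap\Sigma\subset\sigma(S_0(\cdot))\cap\Sigma.$$ (ii) If $\Sigma\subset\Theta$ is such that for all $\lambda\in\Sigma$ condition $(\ast)_\lambda$ holds and $D_0-\lambda\in\mathcal F_+(\mathcal H_2)$, then $$\sigma_{\mathrm{e2}}(\mathcal A_0)\cap\Sigma\subset\s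igma_{\mathrm{e2}}(S_0(\cdot))\cap\Sigma.$$
   Context: Notation. $\mathcal B(\mathcal G_1,\mathcal G_2)$ is the space of everywhere defined bounded linear operators between Hilbert spaces; $\mathcal C(\mathcal G)$ is the set of closed (not necessarily densely defined) linear operators in $\mathcal G$; $\rho,\sigma$ denote resolvent set and spectrum. For a linear operator $T$ in $\mathcal G$, $\operatorname{coker}T:=(\operatorname{ran}T)^\perp$. $\mathcal F_+(\mathcal G)=\{T\in\mathcal C(\mathcal G):\operatorname{ran}T\text{ closed},\dim\ker T<\infty\}$, $\sigma_{\mathrm{e2}}(T)=\{\lambda\in\mathbb C:T-\lambda\notin\mathcal F_+(\mathcal G)\}$. For $T\in\mathcal C(\mathcal G)$ with closed range, the generalised inverse $T^\#\in\mathcal B(\mathcal G)$ is defined by $T^\#x=(T|_{\operatorname{dom}T\cap(\ker T)^\perp})^{-1}x$ for $x\in\operatorname{ran}T$ and $T^\#x=0$ for $x\in\operatorname{coker}T$; writing $T^\#$ presupposes that $T$ is closed with closed range. $T_1\subset T_2$ means $T_2$ extends $T_1$. Assumptions. (a) $\mathcal D_S\subset\mathcal H_1\subset\mathcal D_{-S}$ and $\mathcal D_2\subset\mathcal H_2\subset\mathcal D_{-2}$, where all these canonical embeddings are continuous with dense range; moreover $\mathcal D_{-S}\subset\mathcal D_{-1}$ is continuously embedded. (b) $A\in\mathcal B(\mathcal D_S,\mathcal D_{-1})$, $B\in\mathcal B(\mathcal D_2,\mathcal D_{-1})$, $C\in\mathcal B(\mathcal D_S,\mathcal D_{-2})$.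 (c) $D_0\in\mathcal C(\mathcal H_2)$, $\operatorname{dom}D_0\subset\mathcal D_2$ is dense in $\mathcal D_2$, and there is an extension $D_0\subset D\in\mathcal B(\mathcal D_2,\mathcal D_{-2})$. Definitions. With $\mathcal D:=\mathcal D_S\oplus\mathcal D_2$, $\mathcal D_-:=\mathcal D_{-1}\oplus\mathcal D_{-2}$, $\mathcal H:=\mathcal H_1\oplus\mathcal H_2$, put $\mathcal A:=\begin{pmatrix}A&B\\C&D\end{pmatrix}\in\mathcal B(\mathcal D,\mathcal D_-)$ and $\mathcal A_0:=\mathcal A|_{\operatorname{dom}\mathcal A_0}$, $\operatorname{dom}\mathcal A_0:=\{(f,g)\in\mathcal D:\mathcal A(f,g)\in\mathcal H\}$, an operator in $\mathcal H$. $\Theta\subset\mathbb C$ is a set such that for every $\lambda\in\Theta$ the range of $D_0-\lambda$ is closed in $\mathcal H_2$ and there exists an extension $(D_0-\lambda)^\#\subset D^\ddagger(\lambda)\in\mathcal B(\mathcal D_{-2},\mathcal D_2)$ (fixed for each $\lambda$). For $\lambda\in\Theta$, $$S(\lambda):=A-\lambda-BD^\ddagger(\lambda)C\in\mathcal B(\mathcal D_S,\mathcal D_{-1}),$$ $S_0(\lambda):=S(\lambda)|_{\operatorname{dom}S_0(\lambda)}$, $\operatorname{dom}S_0(\lambda):=\{f\in\mathcal D_S:S(\lambda)f\in\mathcal H_1\}$, an operator in $\mathcal H_1$. For the family, $\sigma(S_0(\cdot)):=\{\lambda\in\Theta:0\in\sigma(S_0(\lambda))\}$ and $\sigma_{\mathrm{e2}}(S_0(\cdot)):=\{\lambda\in\Theta:0\in\sigma_{\mathrm{e2}}(S_0(\lambda))\}$.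 *)

(* Defs.v *)
From HB Require Import structures.
From mathcomp Require Import all_boot all_order all_algebra.
From mathcomp Require Import all_classical all_reals all_analysis.
From mathcomp Require Import ring.

Set Implicit Arguments.
Unset Strict Implicit.
Unset Printing Implicit Defensive.
Import Order.TTheory GRing.Theory Num.Theory.
Import numFieldNormedType.Exports.
Local Open Scope classical_set_scope.
Local Open Scope ring_scope.

(* The inner product is linear in its first argument and conjugate-linear in
   the second one. *)
HB.mixin Record NormedModule_isHilbert (C : numClosedFieldType) V
    & NormedModule C V := {
  inner : {dot V for Num.conj};
  inner_normE : forall x : V, inner x x = `|x| ^+ 2
}.

#[short(type="hilbertType")]
HB.structure Definition Hilbert (C : numClosedFieldType) :=
  {V of CompleteNormedModule C V & NormedModule_isHilbert C V}.

(* The product type [H1 * H2] of the library carries the max norm; [hsum] is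
   an alias of it that carries the Hilbert norm instead. *)
Definition hsum (C : numClosedFieldType) (H1 H2 : hilbertType C) : Type :=
  (H1 * H2)%type.

Section HilbertSum.
Variables (C : numClosedFieldType) (H1 H2 : hilbertType C).
Local Notation H := (hsum H1 H2).

HB.instance Definition _ := GRing.Lmodule.copy H (H1 * H2)%type.

Let norm2 (x : H) : C := sqrtC (`|x.1| ^+ 2 + `|x.2| ^+ 2).

Let sqr_ge0 (a : C) : 0 <= a -> 0 <= a ^+ 2.
Proof. exact: exprn_ge0. Qed.

Let sum2_ge0 (a b : C) : 0 <= a -> 0 <= b -> 0 <= a ^+ 2 + b ^+ 2.
Proof. by move=> a0 b0; rewrite addr_ge0// sqr_ge0. Qed.

Let le_sqrt (a b : C) : 0 <= a -> 0 <= b -> (sqrtC a <= sqrtC b) = (a <= b).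
Proof. by move=> a0 b0; apply: ler_sqrtC. Qed.

Let sqrtM (a b : C) : 0 <= a -> 0 <= b -> sqrtC (a * b) = sqrtC a * sqrtC b.
Proof. by move=> a0 b0; apply: sqrtCM. Qed.

Let minkowski2 (a b c d : C) : 0 <= a -> 0 <= b -> 0 <= c -> 0 <= d ->
  sqrtC ((a + c) ^+ 2 + (b + d) ^+ 2) <=
  sqrtC (a ^+ 2 + b ^+ 2) + sqrtC (c ^+ 2 + d ^+ 2).
Proof.
move=> a0 b0 c0 d0.
have p0 := sum2_ge0 a0 b0; have q0 := sum2_ge0 c0 d0.
have s0 : 0 <= sqrtC (a ^+ 2 + b ^+ 2) by rewrite sqrtC_ge0.
have t0 : 0 <= sqrtC (c ^+ 2 + d ^+ 2) by rewrite sqrtC_ge0.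
have st0 := addr_ge0 s0 t0.
have r0 : 0 <= a * c + b * d by rewrite addr_ge0 ?mulr_ge0.
have ac0 := addr_ge0 a0 c0; have bd0 := addr_ge0 b0 d0.
rewrite -(sqrCK st0) le_sqrt; [|exact: sum2_ge0|exact: sqr_ge0].
rewrite [leRHS]sqrrD !sqrtCK.
have -> : (a + c) ^+ 2 + (b + d) ^+ 2 =
  a ^+ 2 + b ^+ 2 + (a * c + b * d) *+ 2 + (c ^+ 2 + d ^+ 2) by ring.
rewrite lerD2r lerD2l lerMn2r/=.
rewrite -(sqrCK r0) -sqrtM// le_sqrt; [|exact: sqr_ge0|exact: mulr_ge0].
have -> : (a ^+ 2 + b ^+ 2) * (c ^+ 2 + d ^+ 2) =
  (a * c + b * d) ^+ 2 + (a * d - b * c) ^+ 2 by ring.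
by rewrite lerDl real_exprn_even_ge0// rpredB// rpredM// ger0_real.
Qed.

Let ler_norm2D (x y : H) : norm2 (x + y) <= norm2 x + norm2 y.
Proof.
apply: le_trans (minkowski2 (normr_ge0 x.1) (normr_ge0 x.2)
  (normr_ge0 y.1) (normr_ge0 y.2)).
rewrite le_sqrt; [|exact: sum2_ge0|by apply: sum2_ge0; apply: addr_ge0].
by apply: lerD; apply: lerXn2r; rewrite ?nnegrE ?addr_ge0//; apply: ler_normD.
Qed.

Let norm2Z (l : C) (x : H) : norm2 (l *: x) = `|l| * norm2 x.
Proof.
rewrite /norm2 /= !normrZ !exprMn -mulrDr sqrtM ?sqr_ge0 ?sum2_ge0//.
by rewrite sqrCK.
Qed.

Let norm2_eq0 (x : H) : norm2 x = 0 -> x = 0.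
Proof.
move/eqP; rewrite sqrtC_eq0 paddr_eq0 ?sqr_ge0// !expf_eq0/= !normr_eq0.
by case: x => a b /= /andP[/eqP-> /eqP->].
Qed.

HB.instance Definition _ := Lmodule_isNormed.Build C H
  ler_norm2D norm2Z norm2_eq0.

Lemma hsum_normE (x : H) : `|x| = sqrtC (`|x.1| ^+ 2 + `|x.2| ^+ 2).
Proof. by []. Qed.

Lemma hsum_norm_fst (x : H) : `|x.1| <= `|x|.
Proof.
rewrite hsum_normE -{1}(sqrCK (normr_ge0 x.1)) le_sqrt ?sqr_ge0 ?sum2_ge0//.
by rewrite lerDl sqr_ge0.
Qed.

Lemma hsum_norm_snd (x : H) : `|x.2| <= `|x|.
Proof.
rewrite hsum_normE -{1}(sqrCK (normr_ge0 x.2)) le_sqrt ?sqr_ge0 ?sum2_ge0//.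
by rewrite lerDr sqr_ge0.
Qed.

Lemma hsum_norm_le (x : H) : `|x| <= `|x.1| + `|x.2|.
Proof.
have n0 : 0 <= `|x.1| + `|x.2| by rewrite addr_ge0.
rewrite hsum_normE -(sqrCK n0) le_sqrt ?sqr_ge0 ?sum2_ge0//.
by rewrite sqrrD addrAC lerDl mulrn_wge0// mulr_ge0.
Qed.

Let norm_sqr (x : H) : `|x| ^+ 2 = `|x.1| ^+ 2 + `|x.2| ^+ 2.
Proof. by rewrite hsum_normE sqrtCK. Qed.

Let hsum_cauchy (F : set_system H) : ProperFilter F -> cauchy F -> cvg F.
Proof.
move=> FF Fc.
have c1 : cvg ((fst : H -> H1) @ F).
  apply: cauchy_cvg; apply/cauchy_ballP => e e0.
  rewrite near_map2; move/cauchy_ballP : Fc => /(_ e e0).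
  apply: filterS => -[x y]; rewrite -!ball_normE /=.
  exact: le_lt_trans (hsum_norm_fst (x - y)).
have c2 : cvg ((snd : H -> H2) @ F).
  apply: cauchy_cvg; apply/cauchy_ballP => e e0.
  rewrite near_map2; move/cauchy_ballP : Fc => /(_ e e0).
  apply: filterS => -[x y]; rewrite -!ball_normE /=.
  exact: le_lt_trans (hsum_norm_snd (x - y)).
move/cvg_ex : c1 => [l1 l1F]; move/cvg_ex : c2 => [l2 l2F].
apply/cvg_ex; exists ((l1, l2) : H); apply/cvgrPdist_lt => e e0.
near=> x.
apply: le_lt_trans (hsum_norm_le _) _.
rewrite (splitr e) ltrD//=; near: x.
- by move/cvgrPdist_lt : l1F => /(_ (e / 2)); apply; rewrite divr_gt0.
- by move/cvgrPdist_lt : l2F => /(_ (e / 2)); apply; rewrite divr_gt0.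
Unshelve. all: by end_near. Qed.

HB.instance Definition _ := Uniform_isComplete.Build H hsum_cauchy.

Definition hsum_inner (x y : H) : C := inner x.1 y.1 + inner x.2 y.2.

Let hsum_inner_bilinear : bilinear_for *%R (Num.conj \; *%R) hsum_inner.
Proof.
split=> [y|x] a u v; rewrite /hsum_inner /=.
- by rewrite !linearPl /= mulrDr addrACA.
- by rewrite !linearPr /= mulrDr addrACA.
Qed.

HB.instance Definition _ := bilinear_isBilinear.Build C H H C
  *%R (Num.conj \; *%R) hsum_inner hsum_inner_bilinear.

Let hsum_inner_herm (x y : H) :
  hsum_inner x y = (-1) ^+ false * Num.conj (hsum_inner y x).
Proof.
by rewrite expr0 mul1r rmorphD /= /hsum_inner; congr (_ + _);
  rewrite [LHS]hermC/= expr0 mul1r.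
Qed.

HB.instance Definition _ := isHermitianSesquilinear.Build C H false Num.conj
  hsum_inner hsum_inner_herm.

Let hsum_inner_normE (x : H) : hsum_inner x x = `|x| ^+ 2.
Proof. by rewrite norm_sqr /hsum_inner !inner_normE. Qed.

Let hsum_inner_gt0 (x : H) : x != 0 -> 0 < hsum_inner x x.
Proof. by move=> x0; rewrite hsum_inner_normE exprn_gt0// normr_gt0. Qed.

HB.instance Definition _ := isDotProduct.Build C H hsum_inner hsum_inner_gt0.

HB.instance Definition _ :=
  NormedModule_isHilbert.Build C H hsum_inner_normE.

End HilbertSum.

(* An everywhere defined linear map is bounded iff it is continuous, by
   [linear_bounded_continuous]. *)
Definition bounded_op (C : numClosedFieldType) (U V : normedModType C)
    (f : {linear U -> V}) : Prop := bounded_near f (nbhs (0 : U)).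

(* Not necessarily closed or densely defined operators in G, given by their
   graphs. *)
Record operator (C : numClosedFieldType) (G : hilbertType C) := Operator {
  op_graph : set (G * G);
  op_graph0 : op_graph (0, 0);
  op_graphP : forall (a : C) u v,
    op_graph u -> op_graph v -> op_graph (a *: u + v);
  op_graph_fun : forall x y y', op_graph (x, y) -> op_graph (x, y') -> y = y'
}.

Section OperatorTheory.
Variables (C : numClosedFieldType) (G : hilbertType C).
Implicit Types (T : operator G) (lam : C).

Definition op_dom T : set G := [set x | exists y, op_graph T (x, y)].
Definition op_ran T : set G := [set y | exists x, op_graph T (x, y)].
Definition op_ker T : set G := [set x | op_graph T (x, 0)].

Definition orthocomp (E : set G) : set G :=
  [set x | forall y, E y -> inner x y = 0].
Definition op_coker T : set G := orthocomp (op_ran T).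

Definition closed_op T : Prop := closed (op_graph T).

Section Shift.
Variables (T : operator G) (lam : C).

Definition shift_graph : set (G * G) :=
  [set u | op_graph T (u.1, u.2 + lam *: u.1)].

Let shift_graph0 : shift_graph (0, 0).
Proof. by rewrite /shift_graph /= scaler0 addr0; exact: op_graph0. Qed.

Let shift_graphP (a : C) u v :
  shift_graph u -> shift_graph v -> shift_graph (a *: u + v).
Proof.
case: u => u1 u2; case: v => v1 v2 /= Tu Tv.
have := op_graphP a Tu Tv; congr (op_graph T _); congr pair => /=.
by rewrite !scalerDr addrACA !scalerA mulrC.
Qed.

Let shift_graph_fun x y y' :
  shift_graph (x, y) -> shift_graph (x, y') -> y = y'.
Proof. by move=> /= Ty Ty'; exact: addIr (op_graph_fun Ty Ty'). Qed.

(* T - lam, with domain op_dom T. *)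
Definition shift_op : operator G :=
  Operator shift_graph0 shift_graphP shift_graph_fun.

End Shift.

Definition fin_dim (E : set G) : Prop :=
  exists n (e : 'I_n -> G), forall x, E x ->
    exists c : 'I_n -> C, x = \sum_i c i *: e i.

Definition F_plus T : Prop :=
  [/\ closed_op T, closed (op_ran T) & fin_dim (op_ker T)].

(* T - lam is a bijection from op_dom T onto G, and its inverse X is everywhere
   defined and bounded; for a T that is not closed this set is empty. *)
Definition resolvent_set T : set C :=
  [set lam | exists2 X : {linear G -> G}, bounded_op X &
     forall x y, op_graph (shift_op T lam) (x, y) <-> X y = x].

Definition spectrum T : set C := ~` resolvent_set T.

Definition spectrum_e2 T : set C := [set lam | ~ F_plus (shift_op T lam)].

(* X is the generalised inverse of T; the linear map X is determined by its
   values on the closed subspace op_ran T and on op_coker T. *)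
Definition is_gen_inverse T (X : {linear G -> G}) : Prop :=
  [/\ closed_op T, closed (op_ran T), bounded_op X,
      forall x, op_ran T x -> orthocomp (op_ker T) (X x) /\ op_graph T (X x, x)
    & forall x, op_coker T x -> X x = 0].

End OperatorTheory.

(* The canonical embedding of one space into another. *)
Record embedding (C : numClosedFieldType) (U V : normedModType C) := Embedding {
  emb :> {linear U -> V};
  emb_inj : injective emb;
  emb_continuous : continuous emb
}.

Definition dense_range (C : numClosedFieldType) (U V : normedModType C)
  (i : embedding U V) : Prop := dense (range i).

Section EmbeddingTheory.
Variable C : numClosedFieldType.

Section Comp.
Variables (U V W : normedModType C) (j : embedding V W) (i : embedding U V).

Let comp_inj : injective (j \o i : {linear U -> W}).
Proof. by move=> x y /= /emb_inj /emb_inj. Qed.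

Let comp_continuous : continuous (j \o i : {linear U -> W}).
Proof.
by move=> x; apply: continuous_comp; [exact: emb_continuous|
  exact: emb_continuous].
Qed.

Definition comp_emb : embedding U W := Embedding comp_inj comp_continuous.

End Comp.

Section Block.
Variables (U1 U2 V1 V2 : hilbertType C).
Variables (a : {linear U1 -> V1}) (b : {linear U2 -> V1}).
Variables (c : {linear U1 -> V2}) (d : {linear U2 -> V2}).

Definition block_op (u : hsum U1 U2) : hsum V1 V2 :=
  (a u.1 + b u.2, c u.1 + d u.2).

Let block_op_linear : linear block_op.
Proof.
by move=> k u v; congr pair => /=; rewrite !linearP scalerDr addrACA.
Qed.

HB.instance Definition _ := GRing.isLinear.Build C (hsum U1 U2) (hsum V1 V2)
  *:%R block_op block_op_linear.

End Block.

Section HsumEmb.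
Variables (U1 U2 V1 V2 : hilbertType C).
Variables (i1 : embedding U1 V1) (i2 : embedding U2 V2).

Let diag : {linear hsum U1 U2 -> hsum V1 V2} := block_op i1 \0 \0 i2.

Let diag_inj : injective diag.
Proof.
move=> [x1 x2] [y1 y2] [] /=; rewrite !addr0 !add0r.
by move=> /emb_inj -> /emb_inj ->.
Qed.

Let diag_continuous : continuous diag.
Proof.
apply: bounded_linear_continuous; apply/linear_boundedP.
have /linear_bounded_continuous/linear_boundedP b1 := @emb_continuous _ _ _ i1.
have /linear_bounded_continuous/linear_boundedP b2 := @emb_continuous _ _ _ i2.
have [r1 r10 B1] := pinfty_ex_gt0 b1; have [r2 r20 B2] := pinfty_ex_gt0 b2.
near=> r => x.
apply: le_trans (hsum_norm_le _) _ => /=; rewrite addr0 add0r.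
apply: le_trans (lerD (B1 _) (B2 _)) _.
apply: (@le_trans _ _ ((r1 + r2) * `|x|)).
  rewrite mulrDl; apply: lerD; apply: ler_wpM2l; rewrite ?(ltW r10) ?(ltW r20)//.
    exact: hsum_norm_fst.
  exact: hsum_norm_snd.
rewrite ler_wpM2r//; near: r; apply: nbhs_pinfty_ge.
by rewrite rpredD// ?gtr0_real.
Unshelve. all: by end_near. Qed.

Definition hsum_emb : embedding (hsum U1 U2) (hsum V1 V2) :=
  Embedding diag_inj diag_continuous.

End HsumEmb.

Section Part.
Variables (U V : normedModType C) (H : hilbertType C).
Variables (i : embedding U H) (j : embedding H V) (T : {linear U -> V}).

Definition part_graph : set (H * H) :=
  [set u | exists2 f, i f = u.1 & T f = j u.2].

Let part_graph0 : part_graph (0, 0).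
Proof. by exists 0; rewrite /= !linear0. Qed.

Let part_graphP (a : C) u v :
  part_graph u -> part_graph v -> part_graph (a *: u + v).
Proof.
case: u => u1 u2; case: v => v1 v2 [f /= fu Tf] [g /= gv Tg].
by exists (a *: f + g); rewrite /= linearP ?fu ?gv// Tf Tg -linearP.
Qed.

Let part_graph_fun x y y' : part_graph (x, y) -> part_graph (x, y') -> y = y'.
Proof.
move=> [f /= fx Tf] [g /= gx Tg]; apply: (@emb_inj _ _ _ j).
by rewrite -Tf -Tg; congr (T _); apply: (@emb_inj _ _ _ i); rewrite fx gx.
Qed.

(* For U included in H included in V, the operator in H that restricts T to
   the f in U with T f in H. *)
Definition part_op : operator H :=
  Operator part_graph0 part_graphP part_graph_fun.

(* E extends the generalised inverse of X. *)
Definition extends_gen_inverse (X : operator H) (E : {linear V -> U}) : Prop :=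
  exists2 Y : {linear H -> H}, is_gen_inverse X Y &
    forall y, i (E (j y)) = Y y.

End Part.

End EmbeddingTheory.

Section OperatorMatrix.
Variables (C : numClosedFieldType).
Variables (H1 H2 DS D2 DmS Dm1 Dm2 : hilbertType C).
Variables (iS : embedding DS H1) (jS : embedding H1 DmS).
Variables (kS : embedding DmS Dm1).
Variables (i2 : embedding D2 H2) (j2 : embedding H2 Dm2).
Variables (A : {linear DS -> Dm1}) (B : {linear D2 -> Dm1}).
Variables (C' : {linear DS -> Dm2}) (D : {linear D2 -> Dm2}).
Variables (D0 : operator H2) (Theta : set C) (Ddag : C -> {linear Dm2 -> D2}).

Definition matrix_op0 : operator (hsum H1 H2) :=
  part_op (hsum_emb iS i2) (hsum_emb (comp_emb kS jS) j2) (block_op A B C' D).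

(* In A - lam, the scalar lam stands for lam times the embedding of DS into
   Dm1. *)
Definition schur (lam : C) : {linear DS -> Dm1} :=
  A \- (lam \*: (kS \o jS \o iS)) \- (B \o Ddag lam \o C').

Definition schur0 (lam : C) : operator H1 :=
  part_op iS (comp_emb kS jS) (schur lam).

Definition schur0_spectrum : set C :=
  [set lam | Theta lam /\ spectrum (schur0 lam) 0].

Definition schur0_spectrum_e2 : set C :=
  [set lam | Theta lam /\ spectrum_e2 (schur0 lam) 0].

Definition condition_star (lam : C) : Prop :=
  [/\ exists2 S : {linear DS -> DmS},
        bounded_op S & forall f, kS (S f) = schur lam f,
      dense (iS @^-1` op_dom (schur0 lam)),
      B @` (i2 @^-1` op_dom D0) `<=` range kS
    & exists z : C,
        [/\ closed (op_ran (shift_op (schur0 lam) z)),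
            op_coker (shift_op (schur0 lam) z) = [set 0]
          & exists2 E : {linear DmS -> DS}, bounded_op E &
              extends_gen_inverse iS jS (shift_op (schur0 lam) z) E]].

End OperatorMatrix.

(* Main.v *)
Require Import Defs.
From HB Require Import structures.
From mathcomp Require Import all_boot all_order all_algebra.
From mathcomp Require Import complex.
From mathcomp Require Import ring.
From mathcomp Require Import all_classical all_reals all_analysis.

Set Implicit Arguments.
Unset Strict Implicit.
Unset Printing Implicit Defensive.
Import Order.TTheory GRing.Theory Num.Theory.
Import numFieldNormedType.Exports.
Local Open Scope classical_set_scope.
Local Open Scope ring_scope.

(**
For [lambda] in [Theta] one eliminates the second component with the extended
generalised inverse [E] of [D0 - lambda].  The map [g |-> g - E (D - lambda) g]
is, by density of [dom D0], a bounded map onto [ker (D0 - lambda)], and it is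
determined by inner products in [H2] with finitely many kernel vectors.  Up to
this finite-rank term, [(A0 - lambda)(f, g) = (x, y)] reads
[S(lambda) f = x - B E y] and [g = E (y - C f)], where [y |-> B E y] is bounded
from [H2] to [DmS] by the closed graph theorem.

The condition on [S0(lambda) - z] yields [(S(lambda) - z) E' = 1] on the whole
of [DmS].  Hence [x] lies in [ran S(lambda)] iff [z E' x] lies in
[ran S0(lambda)], so [S(lambda) : DS -> DmS] inherits surjectivity or closed
range from [S0(lambda)].  The open mapping theorem then bounds [f] by
[S(lambda) f] and finitely many inner products, and altogether [(f, g)] is
bounded, in the norm of [DS + D2], by [(A0 - lambda)(f, g)] and finitely many
inner products in [H].  Such an estimate forces [A0 - lambda] to be closed with
closed range and finite-dimensional kernel.
*)

(** * Normed spaces over the complex numbers *)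

Section MetricFacts.
Variable K : numFieldType.

Lemma closedP_dist (V : normedModType K) (E : set V) :
  closed E <-> forall x, (forall e, 0 < e -> exists2 y, E y & `|x - y| < e) -> E x.
Proof.
split=> [cE x xE|H].
  apply: cE => B /nbhs_normP[e /= e0 eB].
  by have [y Ey xy] := xE _ e0; exists y; split => //; apply: eB.
move=> x clx; apply: H => e e0.
have [] := clx (ball_ Num.Def.normr x e); first exact/nbhs_normP/(ex_intro2 _ _ e).
by move=> y [Ey xy]; exists y.
Qed.

Lemma closed2P_dist (U V : normedModType K) (E : set (U * V)) :
  closed E <-> forall x y, (forall e, 0 < e ->
    exists u v, [/\ E (u, v), `|x - u| < e & `|y - v| < e]) -> E (x, y).
Proof.
split=> [cE x y xE|H].
  apply: cE => B [[B1 B2] [/= /nbhs_normP[e1 /= e10 eB1]]].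
  move=> /nbhs_normP[e2 /= e20 eB2] BB.
  (* The order of [K] may be partial; the minimum of two radii makes sense because positive elements
     are real, hence comparable. *)
  have r12 : e1 >=< e2 by rewrite real_comparable// gtr0_real.
  have e0 : 0 < Num.min e1 e2 by rewrite comparable_lt_min ?e10.
  have [u [v [Euv xu yv]]] := xE _ e0; exists (u, v); split => //.
  by apply: BB; split; [apply: eB1|apply: eB2] => /=;
    rewrite (lt_le_trans xu, lt_le_trans yv)// comparable_ge_min// lexx ?orbT.
move=> [x y] clx; apply: H => e e0.
have [] := clx (ball_ Num.Def.normr x e `*` ball_ Num.Def.normr y e).
  by exists (ball_ Num.Def.normr x e, ball_ Num.Def.normr y e) => //; split => /=;
    exact/nbhs_normP/(ex_intro2 _ _ e).
by move=> [u v] [Ey [xy1 xy2]]; exists u, v.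
Qed.

Lemma dense_approx (V : normedModType K) (E : set V) (x : V) (e : K) :
  dense E -> 0 < e -> exists2 y, E y & `|x - y| < e.
Proof.
move=> dE e0; have [] := dE (ball x e)°.
- by exists x; exact: nbhsx_ballx.
- exact: open_interior.
move=> y [/interior_subset xy Ey]; exists y => //.
by move: xy; rewrite -ball_normE.
Qed.

Lemma bounded_op_bound (V W : normedModType K) (f : {linear V -> W}) :
  bounded_near f (nbhs (0 : V)) -> exists2 c, 0 < c & forall x, `|f x| <= c * `|x|.
Proof. by move/linear_boundedP/pinfty_ex_gt0. Qed.

(** Nonnegativity makes [x] and [y] comparable in the partial order, so if the conclusion fails then
    [y < x], and half of the gap contradicts the hypothesis. *)
Lemma ge0_ler_addgt0 (x y : K) : 0 <= x -> 0 <= y ->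
  (forall e, 0 < e -> x <= y + e) -> x <= y.
Proof.
move=> x0 y0 H; have [//|yx] := real_leP (ger0_real x0) (ger0_real y0).
have d0 : 0 < (x - y) / 2 by rewrite divr_gt0// subr_gt0.
have := H _ d0; rewrite -lerBlDl => /le_lt_trans.
have /[swap]/[apply] : (x - y) / 2 < x - y.
  by rewrite ltr_pdivrMr// ltr_pMr ?subr_gt0// ltr1n.
by rewrite ltxx.
Qed.

Lemma bounded_op_dist (V W : normedModType K) (f : {linear V -> W}) x :
  bounded_near f (nbhs (0 : V)) -> forall e, 0 < e -> exists2 d, 0 < d &
  forall y, `|x - y| < d -> `|f x - f y| < e.
Proof.
move=> /bounded_op_bound[c c0 fc] e e0; exists (e / c); first exact: divr_gt0.
move=> y xy; rewrite -linearB (le_lt_trans (fc _))// mulrC.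
by rewrite -ltr_pdivlMr.
Qed.

(** By continuity [f x] is a limit of points of [E]. This carries closed conditions from dense sets,
    such as the domain of [D0], to the whole space. *)
Lemma dense_closed_preimage (V W : normedModType K) (f : {linear V -> W})
    (D : set V) (E : set W) : bounded_near f (nbhs (0 : V)) -> dense D ->
  closed E -> (forall x, D x -> E (f x)) -> forall x, E (f x).
Proof.
move=> fb dD /closedP_dist cE H x; apply: cE => e e0.
have [d d0 fd] := bounded_op_dist x fb e0.
have [y Dy xy] := dense_approx x dD d0.
by exists (f y); [exact: H|exact: fd].
Qed.

Lemma closed_set0 (V : normedModType K) : closed [set 0 : V].
Proof.
apply/closedP_dist => x H; apply/eqP; rewrite -normr_eq0 eq_le normr_ge0 andbT.
apply: ge0_ler_addgt0 => // e e0; rewrite add0r.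
by have [_ -> ] := H _ e0; rewrite subr0 => /ltW.
Qed.

Lemma dense_linear_eq (V W : normedModType K) (f g : {linear V -> W})
    (D : set V) : bounded_near f (nbhs (0 : V)) -> bounded_near g (nbhs (0 : V)) ->
  dense D -> {in D, f =1 g} -> f =1 g.
Proof.
move=> fb gb dD fg x; apply/eqP; rewrite -subr_eq0; apply/eqP.
have [c c0 fc] := bounded_op_bound fb; have [d d0 gd] := bounded_op_bound gb.
apply: (@dense_closed_preimage _ _ (f \- g) D [set 0]) => //.
- apply/linear_boundedP; near=> r => y /=.
  apply: le_trans (ler_normB _ _) _; apply: le_trans (lerD (fc _) (gd _)) _.
  rewrite -mulrDl ler_wpM2r//; near: r; apply: nbhs_pinfty_ge.
  by rewrite rpredD// gtr0_real.
- exact: closed_set0.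
- by move=> y Dy; rewrite /= fg ?inE// subrr.
Unshelve. all: by end_near. Qed.

End MetricFacts.

(** * Geometrically convergent sequences over the complex numbers *)

Section Geometric.
Variable R : realType.
Local Notation C := R[i].

Lemma pow2_unbounded (x : C) : x \is Num.real -> exists n, x < 2 ^+ n.
Proof.
move=> /RRe_real <-; set y := complex.Re x.
exists (Num.Def.archi_bound y).
have := upper_nthrootP (leqnn (Num.Def.archi_bound y)).
rewrite -ltcR => /lt_le_trans; apply.
by rewrite rmorphXn/= rmorph_nat.
Qed.

Lemma pow2_small (x e : C) : 0 <= x -> 0 < e -> exists n, x / 2 ^+ n < e.
Proof.
move=> x0 e0.
have xe : x / e \is Num.real by rewrite ger0_real// divr_ge0// ltW.
have [n xn] := pow2_unbounded xe; exists n.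
by rewrite ltr_pdivrMr ?exprn_gt0// mulrC -ltr_pdivrMr.
Qed.

(** The steps from stage [n] on are dominated by a geometric series of ratio 1/2 with sum [2 * r n].
    The radii need not be exactly geometric, as in a nested-ball construction. *)
Lemma halving_cvg (V : completeNormedModType C) (u : nat -> V) (r : nat -> C) :
  (forall n, 0 <= r n) -> (forall n, r n.+1 <= r n / 2) ->
  (forall n, `|u n.+1 - u n| <= r n) ->
  exists l, forall n, `|l - u n| <= 2 * r n.
Proof.
move=> r0 rS ur.
have rk n k : r (n + k)%N <= r n / 2 ^+ k.
  elim: k => [|k IH]; first by rewrite addn0 expr0 divr1.
  rewrite addnS exprSr invfM mulrA; apply: le_trans (rS _) _.
  by rewrite ler_wpM2r.
have r20 n : 0 <= 2 * r n by rewrite mulr_ge0.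
have dist n k : `|u (n + k)%N - u n| <= 2 * r n.
  (* The partial sum of the geometric series makes the induction on [k] close. *)
  suff : `|u (n + k)%N - u n| <= 2 * r n * (1 - (2 ^+ k)^-1).
    by move/le_trans; apply; apply: ler_piMr.
  elim: k => [|k IH]; first by rewrite addn0 !subrr normr0 expr0 invr1 subrr mulr0.
  rewrite -(subrKA (u (n + k)%N)) addnS.
  apply: le_trans (ler_normD _ _) _; apply: le_trans (lerD (ur _) IH) _.
  apply: le_trans (lerD (rk _ _) (lexx _)) _.
  rewrite le_eqVlt; apply/orP; left; apply/eqP.
  rewrite exprS; field.
  by rewrite !expf_neq0//= pnatr_eq0.
have rsmall e : 0 < e -> exists n, 2 * r n < e.
  move=> e0; have [n ne] := pow2_small (r20 0%N) e0; exists n.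
  by apply: le_lt_trans ne; rewrite -mulrA ler_wpM2l// -[n]add0n.
have : cauchy (u @ \oo).
  apply: cauchy_exP => e e0; have [n ne] := rsmall e e0.
  exists (u n); exists n => // m /= nm; rewrite -ball_normE /ball_/= distrC.
  by apply: le_lt_trans ne; rewrite -(subnKC nm).
move/cauchy_cvg/cvg_ex => [l ul]; exists l => n.
apply: ge0_ler_addgt0 => // e e0.
move/cvgrPdist_lt : ul => /(_ e e0) [N _ HN].
have := HN (n + N)%N (leq_addl _ _) => /= lN.
rewrite -(subrKA (u (n + N)%N)).
by apply: le_trans (ler_normD _ _) _; rewrite addrC lerD ?(ltW lN).
Qed.

Lemma geometric_cvg (V : completeNormedModType C) (u : nat -> V) (c : C) :
  0 <= c -> (forall n, `|u n.+1 - u n| <= c / 2 ^+ n) ->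
  exists l, forall n, `|l - u n| <= 2 * c / 2 ^+ n.
Proof.
move=> c0 uc; have [n|n|//|l Hl] := @halving_cvg V u (fun n => c / 2 ^+ n).
- by rewrite divr_ge0 ?exprn_ge0.
- by rewrite exprSr invfM mulrA.
by exists l => n; rewrite -mulrA.
Qed.

End Geometric.

(** * Orthogonal projections *)

Section InnerProduct.
Variables (K : numClosedFieldType) (H : hilbertType K).
Implicit Types (x y u v : H) (a : K).

Lemma innerBl x y v : inner (x - y) v = inner x v - inner y v.
Proof. exact: linearBl. Qed.

Lemma innerDl x y v : inner (x + y) v = inner x v + inner y v.
Proof. exact: linearDl. Qed.

Lemma innerZl a x v : inner (a *: x) v = a * inner x v.
Proof. exact: linearZl_LR. Qed.

Lemma inner0l v : inner 0 v = 0.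
Proof. exact: linear0l. Qed.

Lemma innerBr x y v : inner v (x - y) = inner v x - inner v y.
Proof. exact: linearBr. Qed.

Lemma innerZr a x v : inner v (a *: x) = a^* * inner v x.
Proof. exact: linearZr_LR. Qed.

Lemma inner_conj x y : inner x y = (inner y x)^*.
Proof. by rewrite [LHS]hermC/= expr0 mul1r. Qed.

Lemma inner0C x y : inner x y = 0 -> inner y x = 0.
Proof. by rewrite inner_conj => /eqP; rewrite conjC_eq0 => /eqP. Qed.

(* For [v = 0] the quotients are [0]. *)
Lemma norm_sub_proj y v :
  `|y - (inner y v / `|v| ^+ 2) *: v| ^+ 2 =
  `|y| ^+ 2 - `|inner y v| ^+ 2 / `|v| ^+ 2.
Proof.
have [->|v0] := eqVneq v 0.
  by rewrite scaler0 subr0 normr0 expr0n/= invr0 mulr0 subr0.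
have sr : (inner y v / `|v| ^+ 2)^* = (inner y v)^* / `|v| ^+ 2.
  rewrite rmorphM/=; congr (_ * _).
  by rewrite conj_Creal// rpredV rpredX// normr_real.
rewrite -inner_normE innerBl !innerBr !innerZl !innerZr !inner_normE.
rewrite (inner_conj v y) normCK sr.
by field; rewrite normr_eq0.
Qed.

Lemma cauchy_schwarz x y : `|inner x y| <= `|x| * `|y|.
Proof.
have [->|y0] := eqVneq y 0.
  by rewrite inner_conj inner0l conjC0 !normr0 mulr0.
have := exprn_ge0 2 (normr_ge0 (x - (inner x y / `|y| ^+ 2) *: y)).
rewrite norm_sub_proj subr_ge0 ler_pdivrMr ?exprn_gt0 ?normr_gt0//.
by rewrite -exprMn ler_pXn2r// ?nnegrE ?mulr_ge0.
Qed.

Lemma parallelogram x y :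
  `|x + y| ^+ 2 + `|x - y| ^+ 2 = 2 * (`|x| ^+ 2 + `|y| ^+ 2).
Proof. by rewrite -!inner_normE dnormD dnormB; ring. Qed.

(** This is the closedness of the hyperplane orthogonal to [y], a consequence of the Cauchy-Schwarz
    inequality. *)
Lemma inner_eq0_small x y :
  (forall e, 0 < e -> exists2 z, inner z y = 0 & `|x - z| < e) -> inner x y = 0.
Proof.
move=> xy; apply/eqP; rewrite -normr_eq0 eq_le normr_ge0 andbT.
apply: ge0_ler_addgt0 => // e e0; rewrite add0r.
have y1 : 0 < `|y| + 1 by rewrite ltr_wpDl.
have [z zy xz] := xy _ (divr_gt0 e0 y1).
have -> : inner x y = inner (x - z) y by rewrite innerBl zy subr0.
apply: le_trans (cauchy_schwarz _ _) _.
apply: le_trans (ler_wpM2r _ (ltW xz)) _ => //.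
by rewrite mulrAC ler_pdivrMr// ler_pM2l// lerDl.
Qed.

End InnerProduct.

(** Stated for bare sets, so that it applies to linear relations in a product as well as to sets of
    vectors. *)
Definition subspace_set (K : pzRingType) (V : lmodType K) (W : set V) : Prop :=
  W 0 /\ forall (a : K) u v, W u -> W v -> W (a *: u + v).

Section Subspace.
Variables (K : pzRingType) (V : lmodType K) (W : set V).
Hypothesis sW : subspace_set W.

Lemma subspaceD u v : W u -> W v -> W (u + v).
Proof. by move=> Wu Wv; rewrite -[u]scale1r; apply: sW.2. Qed.

Lemma subspaceZ a u : W u -> W (a *: u).
Proof. by move=> Wu; rewrite -[_ *: _]addr0; apply: sW.2 => //; exact: sW.1. Qed.

Lemma subspaceB u v : W u -> W v -> W (u - v).
Proof. by move=> Wu Wv; rewrite -scaleN1r addrC; apply: sW.2. Qed.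

End Subspace.

Section Projection.
Variables (R : realType) (H : hilbertType R[i]).
Local Notation C := R[i].

(** A sequence in [W] minimising the distance to [x] is Cauchy by the parallelogram identity, and
    near-minimality makes [x - w n] nearly orthogonal to [W]. *)
Lemma orthogonal_projection (W : set H) : subspace_set W -> closed W ->
  forall x, exists2 w, W w & forall v, W v -> inner (x - w) v = 0.
Proof.
move=> sW cW x.
(* The infimum is taken over real numbers in [R] and then embedded into [R[i]]. *)
pose D : set R := [set complex.Re (`|x - w| ^+ 2) | w in W].
have ReK (y : H) : (complex.Re (`|y| ^+ 2))%:C%C = `|y| ^+ 2.
  by rewrite RRe_real// rpredX// normr_real.
have D0 : D !=set0.
  by exists (complex.Re (`|x - 0| ^+ 2)); exists 0 => //; exact: sW.1.
have lbD : has_inf D.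
  split => //; exists 0 => _ [w _ <-].
  by rewrite -ler0c ReK exprn_ge0.
pose d : C := (inf D)%:C%C.
have dle w : W w -> d <= `|x - w| ^+ 2.
  by move=> Ww; rewrite -ReK lecR; apply: ge_inf; [exact: lbD.2|exists w].
have app n : exists w, W w /\ `|x - w| ^+ 2 < d + (1 / 2 ^+ n) ^+ 2.
  have e0 : 0 < ((1 / 2 ^+ n) ^+ 2 : R) by rewrite exprn_gt0// divr_gt0 ?exprn_gt0.
  have [_ [w Ww <-] Hw] := inf_adherent e0 lbD; exists w; split => //.
  move: Hw; rewrite -ltcR ReK rmorphD/= => /lt_le_trans; apply.
  by rewrite lerD2l rmorphXn/= fmorph_div/= rmorphXn/= rmorph1 rmorph_nat.
have [w Hw] := choice app.
have orth n v : W v -> `|inner (x - w n) v| <= 1 / 2 ^+ n * `|v|.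
  move=> Wv; have [->|v0] := eqVneq v 0.
    by rewrite inner_conj inner0l conjC0 !normr0 mulr0.
  rewrite -(@ler_pXn2r _ 2) ?nnegrE ?mulr_ge0 ?divr_ge0 ?exprn_ge0//.
  rewrite exprMn -ler_pdivrMr ?exprn_gt0 ?normr_gt0//.
  (* Moving [w n] by the best multiple of [v] cannot bring the squared distance below [d], so the
     gain computed in [norm_sub_proj] is at most the squared error. *)
  have := dle _ (sW.2 (inner (x - w n) v / `|v| ^+ 2) _ _ Wv (Hw n).1).
  rewrite opprD addrCA addrC norm_sub_proj lerBrDr => H1.
  by have := le_lt_trans H1 (Hw n).2; rewrite ltrD2l => /ltW.
have [|l Hl] := @geometric_cvg _ _ w 2 (ler0n _ _).
  move=> n; have := parallelogram (x - w n) (x - w n.+1).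
  have -> : x - w n - (x - w n.+1) = w n.+1 - w n.
    by rewrite opprB addrC addrA subrK.
  have -> : x - w n + (x - w n.+1) = 2 *: (x - (1 / 2) *: (w n + w n.+1)).
    rewrite scalerBr scalerA mul1r divff ?pnatr_eq0// scale1r scaler_nat mulr2n.
    by rewrite addrACA opprD.
  rewrite normrZ ger0_norm// exprMn => H1.
  (* The midpoint lies in [W], so its squared distance to [x] is at least [d]; the parallelogram
     identity then leaves at most four squared errors. *)
  have Wm : W ((1 / 2) *: (w n + w n.+1)).
    by apply: subspaceZ => //; apply: subspaceD; [|exact: (Hw _).1..].
  rewrite -(@ler_pXn2r _ 2) ?nnegrE ?divr_ge0 ?exprn_ge0//.
  have q0 : 0 < (2 ^+ n : C) by rewrite exprn_gt0.
  have a1 := ltW (Hw n).2; have a2 := ltW (Hw n.+1).2; have a3 := dle _ Wm.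
  have -> : `|w n.+1 - w n| ^+ 2 = 2 * (`|x - w n| ^+ 2 + `|x - w n.+1| ^+ 2) -
    2 ^+ 2 * `|x - (1 / 2) *: (w n + w n.+1)| ^+ 2 by rewrite -H1 addrAC subrr add0r.
  pose q : C := (1 / 2 ^+ n) ^+ 2.
  apply: (@le_trans _ _ (2 * (d + q + (d + q)) - 2 ^+ 2 * d)).
    apply: lerB; last by rewrite ler_pM2l// exprn_gt0.
    rewrite ler_pM2l//; apply: lerD => //; apply: le_trans a2 _.
    rewrite lerD2l ler_pXn2r ?nnegrE ?divr_ge0 ?exprn_ge0//.
    by rewrite ler_pM2l// lef_pV2 ?posrE ?exprn_gt0// exprS ler_peMl ?ler1n// ltW.
  rewrite /q le_eqVlt; apply/orP; left; apply/eqP; field.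
  by rewrite gt_eqF.
have two_small (e : C) : 0 < e -> exists n, 2 * 2 / 2 ^+ n < e.
  by move=> e0; apply: pow2_small => //; rewrite mulr_ge0.
exists l.
  move/closedP_dist : cW; apply => e /two_small[n ne].
  by exists (w n); [exact: (Hw n).1|exact: le_lt_trans (Hl n) ne].
move=> v Wv; apply/eqP; rewrite -normr_eq0 eq_le normr_ge0 andbT.
apply: ge0_ler_addgt0 => // e e0; rewrite add0r.
(* The 5 is 1 from [orth] plus 4 from the distance of [l] to [w n]. *)
have [n ne] := pow2_small (mulr_ge0 (ler0n _ 5) (normr_ge0 v)) e0.
apply: le_trans (ltW ne).
have -> : x - l = (x - w n) - (l - w n) by rewrite opprB addrA addrNK.
rewrite innerBl; apply: le_trans (ler_normB _ _) _.
apply: le_trans (lerD (orth n v Wv) (cauchy_schwarz _ _)) _.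
apply: le_trans (lerD (lexx _) (ler_wpM2r _ (Hl n))) _ => //.
rewrite le_eqVlt; apply/orP; left; apply/eqP; field.
by rewrite expf_neq0// pnatr_eq0.
Qed.

(** Later this turns a closed range with trivial cokernel into surjectivity. *)
Lemma closed_orthocomp0 (W : set H) : subspace_set W -> closed W ->
  orthocomp W = [set 0] -> W = setT.
Proof.
move=> sW cW W0; apply/seteqP; split => // x _.
have [w Ww xw] := orthogonal_projection sW cW x.
have : [set 0] (x - w) by rewrite -W0 => v Wv; exact: xw.
by move=> /= /eqP; rewrite subr_eq0 => /eqP ->.
Qed.

End Projection.

(** * The open mapping theorem *)

Section OpenMapping.
Variables (R : realType) (U V : completeNormedModType R[i]).
Local Notation C := R[i].
Variable Gam : set (U * V).
Let W : set V := [set v | exists u, Gam (u, v)].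
Hypotheses (sG : subspace_set Gam) (cG : closed Gam) (cW : closed W).

Let sW : subspace_set W.
Proof.
split; first by exists 0; exact: sG.1.
move=> a v1 v2 [u1 G1] [u2 G2]; exists (a *: u1 + u2).
exact: (sG.2 a _ _ G1 G2).
Qed.

(* Baire's argument by hand: [W] is a closed subset of [V], not a complete type
   to which the library's theorem would apply. *)
Let locally_almost_open : exists n w r, [/\ W w, 0 < r &
  forall y, W y -> `|y - w| <= r -> forall e, 0 < e ->
    exists u v, [/\ Gam (u, v), `|u| <= 2 ^+ n & `|y - v| < e]].
Proof.
apply: contrapT => H.
(* If the claim fails, every ball centred in [W] contains a smaller one that avoids the image of the
   vectors of norm at most [2 ^+ n]. The pair [(0, 0)] is a dummy for data violating the
   premises. *)
have step (p : nat * (V * C)) : exists q : V * C,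
    W p.2.1 -> 0 < p.2.2 ->
    [/\ W q.1, 0 < q.2 <= p.2.2 / 2, `|q.1 - p.2.1| <= p.2.2 &
      forall u v, Gam (u, v) -> `|u| <= 2 ^+ p.1 -> ~ `|q.1 - v| <= 2 * q.2].
  case: p => n [w r] /=; have [Ww|] := pselect (W w); last by exists (0, 0).
  have [r0|] := boolP (0 < r); last by exists (0, 0).
  suff [y [e [Wy yw e0 ye]]] : exists y e, [/\ W y, `|y - w| <= r, 0 < e &
      forall u v, Gam (u, v) -> `|u| <= 2 ^+ n -> ~ `|y - v| < e].
    have r2 : 0 < r / 2 by rewrite divr_gt0.
    have e4 : 0 < e / 4 by rewrite divr_gt0.
    have cmp : r / 2 >=< e / 4 by rewrite real_comparable// gtr0_real.
    (* With [e / 4], even the ball of twice the new radius, where the limit will lie, stays inside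
       the excluded ball of radius [e]. *)
    exists (y, Num.min (r / 2) (e / 4)) => _ _; split => //=.
      by rewrite comparable_lt_min// r2 e4 comparable_ge_min// lexx.
    move=> u v Guv un yv; apply: (ye u v Guv un); apply: le_lt_trans yv _.
    apply: (@le_lt_trans _ _ (2 * (e / 4))).
      by rewrite ler_pM2l// comparable_ge_min// lexx orbT.
    by rewrite mulrCA gtr_pMr// ltr_pdivrMr// mul1r ltr_nat.
  apply: contrapT => H2; apply: H; exists n, w, r; split => // y Wy yw e e0.
  apply: contrapT => H3; apply: H2; exists y, e; split => // u v Guv un yv.
  by apply: H3; exists u, v.
have [g Hg] := choice step.
pose s := fix s n : V * C := if n is m.+1 then g (m, s m) else (0, 1).
have sP n : W (s n).1 /\ 0 < (s n).2.
  elim: n => [|n [IH1 IH2]] /=; first by split => //; exact: sW.1.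
  by have [? /andP[? _] _ _] := Hg (n, s n) IH1 IH2.
have [n|n|n|l Hl] := @halving_cvg _ _ (fun n => (s n).1) (fun n => (s n).2).
- exact/ltW/(sP n).2.
- by have [_ /andP[_ ?] _ _] := Hg (n, s n) (sP n).1 (sP n).2.
- by have [_ _ ? _] := Hg (n, s n) (sP n).1 (sP n).2.
have rk n : (s n).2 <= 1 / 2 ^+ n.
  elim: n => [|n IH]; first by rewrite expr0 divr1.
  have [_ /andP[_ le_s] _ _] := Hg (n, s n) (sP n).1 (sP n).2.
  by apply: le_trans le_s _; rewrite exprSr invfM mulrA ler_wpM2r.
have [u Gul] : W l.
  move/closedP_dist : cW; apply => e e0.
  have [n ne] := pow2_small (ler0n C 2) e0; exists (s n).1; first exact: (sP n).1.
  apply: le_lt_trans (Hl n) _; apply: le_lt_trans ne.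
  by rewrite ler_pM2l// -div1r.
(* The limit has a preimage [u] of norm at most some [2 ^+ n], which stage [n] has excluded. *)
have [n /ltW un] := pow2_unbounded (normr_real u).
have [_ _ _ /(_ u l Gul un)] := Hg (n, s n) (sP n).1 (sP n).2; apply.
by rewrite distrC; exact: (Hl n.+1).
Qed.

(** Scale [y] to length [r], approximate both [t *: y + w] and [w], subtract and scale back. The two
    preimages of norm at most [2 ^+ n] and the factor [1 / t] give the constant. *)
Let almost_open : exists2 k, 0 < k & forall y, W y -> forall e, 0 < e ->
    exists u v, [/\ Gam (u, v), `|u| <= k * `|y| & `|y - v| < e].
Proof.
have [n [w [r [Ww r0 Hw]]]] := locally_almost_open.
have p0 : 0 < (2 ^+ n : C) by rewrite exprn_gt0.
exists (2 * 2 ^+ n / r); first by rewrite divr_gt0// mulr_gt0.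
move=> y Wy e e0; have [->|y0] := eqVneq y 0.
  by exists 0, 0; rewrite !normr0 mulr0 subr0 normr0; split => //; exact: sG.1.
have ny : 0 < `|y| by rewrite normr_gt0.
pose t := r / `|y|; have t0 : 0 < t by rewrite divr_gt0.
have et0 : 0 < e * t / 2 by rewrite divr_gt0// mulr_gt0.
have [||u1 [v1 [G1 u1n v1e]]] := Hw (t *: y + w) _ _ _ et0.
- exact: sW.2.
- by rewrite addrK normrZ gtr0_norm// divfK// gt_eqF.
have [||u0 [v0 [G0 u0n v0e]]] := Hw w _ _ _ et0 => //.
  by rewrite subrr normr0 ltW.
exists (t^-1 *: (u1 - u0)), (t^-1 *: (v1 - v0)); split.
- exact: (subspaceZ sG t^-1 (subspaceB sG G1 G0)).
- rewrite normrZ gtr0_norm ?invr_gt0// /t invf_div mulrC mulrA mulrAC.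
  rewrite ler_pM2r// ler_pM2r ?invr_gt0//.
  by apply: le_trans (ler_normB _ _) _; rewrite mulr_natl mulr2n lerD.
- have -> : y - t^-1 *: (v1 - v0) = t^-1 *: ((t *: y + w - v1) - (w - v0)).
    rewrite (addrAC (t *: y)) (opprB w) addrACA subrr addr0.
    rewrite -addrA [- v1 + v0]addrC -(opprB v1 v0) (scalerBr t^-1 (t *: y)).
    by rewrite scalerA mulVf ?gt_eqF// scale1r.
  rewrite normrZ gtr0_norm ?invr_gt0// mulrC ltr_pdivrMr//.
  by apply: le_lt_trans (ler_normB _ _) _; rewrite (splitr (e * t)) ltrD.
Qed.

(** Correct the remaining error again and again, halving it each time: the corrections sum to at
    most [2 * k] times the norm of [v], and closedness puts the limit into [Gam]. For relations,
    this covers the open mapping and the closed graph theorem at once. *)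
Lemma open_mapping_relation : exists2 c, 0 < c &
  forall v, W v -> exists2 u, Gam (u, v) & `|u| <= c * `|v|.
Proof.
have [k k0 Hk] := almost_open; exists (2 * k); first by rewrite mulr_gt0.
move=> y Wy; have [->|y0] := eqVneq y 0.
  by exists 0; [exact: sG.1|rewrite !normr0 mulr0].
have ny : 0 < `|y| by rewrite normr_gt0.
have ny2 n : 0 < `|y| / 2 ^+ n by rewrite divr_gt0// exprn_gt0.
have step (p : nat * (U * V)) : exists q : U * V, W p.2.2 ->
    [/\ Gam (q.1, q.2), `|q.1| <= k * `|p.2.2| &
        `|p.2.2 - q.2| < `|y| / 2 ^+ p.1.+1].
  have [Wp|] := pselect (W p.2.2); last by exists (0, 0).
  by have [u [v Huv]] := Hk _ Wp _ (ny2 p.1.+1); exists (u, v).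
have [g Hg] := choice step.
(* The first component accumulates the preimage, the second is the part of [y] still to be
   reached. *)
pose s := fix s n : U * V :=
  if n is m.+1 then ((s m).1 + (g (m, s m)).1, (s m).2 - (g (m, s m)).2) else (0, y).
have sP n : [/\ W (s n).2, `|(s n).2| <= `|y| / 2 ^+ n & Gam ((s n).1, y - (s n).2)].
  elim: n => [|n [IH1 IH2 IH3]] /=.
    by rewrite expr0 divr1 subrr; split => //; exact: sG.1.
  have [G1 G2 G3] := Hg (n, s n) IH1; split.
  - by apply: subspaceB => //; exists (g (n, s n)).1.
  - exact: ltW.
  - by have := subspaceD sG IH3 G1; rewrite opprB addrA addrAC.
have [||l Hl] := @geometric_cvg R U (fun n => (s n).1) (k * `|y|).
- by rewrite mulr_ge0// ltW.
- move=> n /=; rewrite addrAC subrr add0r.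
  have [H1 H2 _] := sP n; have [_ G2 _] := Hg (n, s n) H1.
  by apply: le_trans G2 _; rewrite -mulrA ler_pM2l.
exists l; last by have := Hl 0%N; rewrite /= subr0 expr0 divr1 mulrA.
move/closed2P_dist : cG; apply => e e0.
have c0 : 0 <= 2 * (k * `|y|) + `|y| by rewrite addr_ge0// !mulr_ge0// ltW.
have [n ne] := pow2_small c0 e0.
exists (s n).1, (y - (s n).2); have [H1 H2 H3] := sP n; split => //.
- apply: le_lt_trans (Hl n) _; apply: le_lt_trans ne.
  by rewrite ler_pM2r ?invr_gt0 ?exprn_gt0// lerDl.
- rewrite subKr; apply: le_lt_trans H2 _; apply: le_lt_trans ne.
  by rewrite ler_pM2r ?invr_gt0 ?exprn_gt0// lerDr !mulr_ge0// ltW.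
Qed.

End OpenMapping.

(** * Finite-dimensional kernels and closed ranges *)

Section FiniteDimension.
Variables (K : numClosedFieldType) (H : hilbertType K).
Implicit Types (E : set H) (s : seq H).

Definition slice E (h : H) : set H := [set x | E x /\ inner x h = 0].

Lemma subspace_slice E h : subspace_set E -> subspace_set (slice E h).
Proof.
move=> sE; split; first by split; [exact: sE.1|exact: inner0l].
move=> a u v [Eu uh] [Ev vh]; split; first exact: sE.2.
by rewrite innerDl innerZl uh vh mulr0 addr0.
Qed.

(** Gram-Schmidt: split off a unit vector [v] of [E]; the part of [E] orthogonal to [v] is spanned
    by one vector fewer. *)
Lemma fin_dim_frame E : subspace_set E -> fin_dim E ->
  exists s, {in s, forall e, E e} /\
    forall x, E x -> x = \sum_(e <- s) inner x e *: e.
Proof.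
move=> sE [n [e He]]; elim: n => [|n IH] in E e sE He *.
  exists [::]; split => // x /He[c ->]; by rewrite big_ord0 big_nil.
have [[v0 Ev0 v0n]|E0] := pselect (exists2 v, E v & v != 0); last first.
  exists [::]; split => // x Ex; rewrite big_nil.
  by apply/eqP/negPn/negP => xn; apply: E0; exists x.
pose v := `|v0|^-1 *: v0.
have Ev : E v by exact: subspaceZ.
have v1 : inner v v = 1.
  rewrite inner_normE normrZ normfV normr_id mulVf ?expr1n//.
  by rewrite normr_eq0.
have [c Hc] := He _ Ev.
have [j cj] : exists j, c j != 0.
  apply: contrapT => cN; move: v1; rewrite {1}Hc big1 ?inner0l.
    by move/eqP; rewrite eq_sym oner_eq0.
  move=> i _; have [->|ci] := eqVneq (c i) 0; first by rewrite scale0r.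
  by exfalso; apply: cN; exists i.
(* As [c j] is nonzero, [v] can replace the generator [e j]; the other generators are projected onto
   the complement of [v]. *)
pose e' i := e (lift j i) - inner (e (lift j i)) v *: v.
have [||s [sE' Hs]] := IH (slice E v) e'; first exact: subspace_slice.
  move=> x [Ex xv]; have [d Hd] := He _ Ex.
  pose t := d j / c j; pose a i := d (lift j i) - t * c (lift j i).
  have xE : x = t *: v + \sum_i a i *: e (lift j i).
    rewrite Hc Hd !(bigD1_ord j)//= scalerDr scalerA divfK// -addrA; congr (_ + _).
    rewrite scaler_sumr -big_split; apply: eq_bigr => i _ /=.
    by rewrite scalerA -scalerDl addrC subrK.
  exists a; rewrite /e'; under eq_bigr do rewrite scalerBr scalerA.
  rewrite sumrB -scaler_suml.
  (* Orthogonality of [x] to [v] forces the components along [v] to cancel. *)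
  suff -> : \sum_i a i * inner (e (lift j i)) v = - t.
    by rewrite scaleNr opprK addrC -xE.
  apply/eqP; rewrite -addr_eq0 addrC -[t]mulr1 -v1 -innerZl; apply/eqP.
  rewrite -[RHS]xv xE innerDl; congr (_ + _).
  by rewrite [RHS]linear_sumlz; apply: eq_bigr => i _; rewrite /= innerZl.
exists (v :: s); split.
  by move=> x; rewrite inE => /predU1P[->//|/sE'[]].
move=> x Ex; rewrite big_cons.
have Ex' : slice E v (x - inner x v *: v).
  split; last by rewrite innerBl innerZl v1 mulr1 subrr.
  by apply: subspaceB => //; apply: subspaceZ.
rewrite -[LHS](subrK (inner x v *: v)) addrC; congr (_ + _).
rewrite {1}(Hs _ Ex') big_seq [RHS]big_seq; apply: eq_bigr => y ys.
have [_ yv] := sE' _ ys.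
by rewrite innerBl innerZl (inner0C yv) mulr0 subr0.
Qed.

(** Passing to the vectors orthogonal to one [h] of [s] lowers the dimension by at most one; a
    vector [w] not orthogonal to [h] restores it. *)
Lemma fin_dim_separated E s : subspace_set E ->
  (forall x, E x -> {in s, forall h, inner x h = 0} -> x = 0) -> fin_dim E.
Proof.
elim: s => [|h s IH] in E * => sE sep.
  exists 0%N, (fun=> 0) => x Ex; exists (fun=> 0).
  by rewrite big_ord0; apply: sep.
have [[w Ew wh]|E0] := pselect (exists2 w, E w & inner w h != 0); last first.
  apply: IH => // x Ex xs; apply: sep => // g.
  rewrite inE => /predU1P[->|]; last exact: xs.
  by apply/eqP/negPn/negP => xn; apply: E0; exists x.
have [|n [e He]] := IH (slice E h) (subspace_slice h sE).
  move=> x [Ex xh] xs; apply: sep => // g; rewrite inE => /predU1P[->//|].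
  exact: xs.
exists n.+1, (fun i => if unlift ord0 i is Some j then e j else w) => x Ex.
pose t := inner x h / inner w h.
have [|c Hc] := He (x - t *: w).
  split; last by rewrite innerBl innerZl divfK// subrr.
  by apply: subspaceB => //; apply: subspaceZ.
exists (fun i => if unlift ord0 i is Some j then c j else t).
rewrite big_ord_recl unlift_none; under eq_bigr do rewrite liftK.
by rewrite -Hc addrC subrK.
Qed.

End FiniteDimension.

(** * Closed ranges from estimates modulo finitely many inner products *)

Section ClosedRange.
Variable R : realType.
Local Notation C := R[i].

(* Only the component of [v] orthogonal to [M] matters, and the coefficient of
   that component is a continuous function of [x]. *)
Lemma closed_add_line (H : hilbertType C) (M : set H) (v : H) :
  subspace_set M -> closed M -> closed [set x | exists a, M (x - a *: v)].
Proof.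
move=> sM cM; have [m Mm vm] := orthogonal_projection sM cM v.
set w := v - m in vm.
have vE : v = m + w by rewrite addrC subrK.
clearbody w.
have [w0|w0] := eqVneq w 0.
  have Mv : M v by rewrite vE w0 addr0.
  have -> : [set x | exists a, M (x - a *: v)] = M; last by [].
  apply/seteqP; split => x /=.
    move=> [a Mx]; rewrite -[x](subrK (a *: v)).
    by apply: subspaceD => //; apply: subspaceZ.
  by move=> Mx; exists 0; rewrite scale0r subr0.
have ww : inner w w != 0 by rewrite inner_normE expf_neq0// normr_eq0.
have mw y : M y -> inner y w = 0 by move=> My; apply: inner0C; exact: vm.
(* The orthogonal projection along [w] does not increase distances, and it maps [M] plus the line of
   [v] into [M]. *)
pose pi y := y - (inner y w / `|w| ^+ 2) *: w.
apply/closedP_dist => x Hx; exists (inner x w / `|w| ^+ 2).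
rewrite vE scalerDr opprD addrA addrAC.
apply: subspaceB => //; last exact: subspaceZ.
change (M (pi x)); move/closedP_dist : cM; apply => e e0.
have [y [a Hy] xy] := Hx _ e0; exists (pi y).
  have yE : inner y w = a * `|w| ^+ 2.
    rewrite -[y](subrK (a *: v)) innerDl (mw _ Hy) add0r innerZl vE innerDl.
    by rewrite (mw _ Mm) add0r inner_normE.
  rewrite /pi yE mulfK -?inner_normE//.
  have -> : y - a *: w = y - a *: v + a *: m.
    by rewrite vE scalerDr opprD addrA addrAC subrK.
  by apply: subspaceD => //; apply: subspaceZ.
apply: le_lt_trans xy.
have -> : pi x - pi y = (x - y) - (inner (x - y) w / `|w| ^+ 2) *: w.
  by rewrite /pi innerBl mulrBl scalerBl opprD addrACA -opprD.
rewrite -(@ler_pXn2r _ 2) ?nnegrE// norm_sub_proj gerBl.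
by rewrite divr_ge0// exprn_ge0.
Qed.

(* Induction on [s]: the part of [Gam] orthogonal to one [h] has codimension at
   most one, so its range lacks at most a line. *)
Lemma closed_range_estimate (U V : hilbertType C) (Gam : set (U * V))
    (s : seq U) (c : C) : 0 <= c -> subspace_set Gam -> closed Gam ->
  (forall u v, Gam (u, v) -> `|u| <= c * (`|v| + \sum_(h <- s) `|inner u h|)) ->
  closed [set v | exists u, Gam (u, v)].
Proof.
move=> c0; elim: s => [|h s IH] in Gam * => sG cG est.
  have {}est u v : Gam (u, v) -> `|u| <= c * `|v|.
    by move=> /est; rewrite big_nil addr0.
  apply/closedP_dist => y Hy.
  have pw n : 0 < (1 / 2 ^+ n : C) by rewrite divr_gt0// exprn_gt0.
  have step n : exists p : U * V, Gam (p.1, p.2) /\ `|y - p.2| < 1 / 2 ^+ n.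
    by have [v [u Guv] yv] := Hy _ (pw n); exists (u, v).
  have [g Hg] := choice step.
  have [||l Hl] := @geometric_cvg R U (fun n => (g n).1) (c * 2).
  - by rewrite mulr_ge0.
  - move=> n; have [G1 y1] := Hg n; have [G2 y2] := Hg n.+1.
    apply: le_trans (est _ _ (subspaceB sG G2 G1)) _.
    rewrite -mulrA ler_wpM2l//.
    have -> : (g n.+1).2 - (g n).2 = (y - (g n).2) - (y - (g n.+1).2).
      by rewrite opprB [RHS]addrC addrA subrK.
    apply: le_trans (ler_normB _ _) _.
    rewrite mulrDl lerD ?(ltW y1)//; apply: le_trans (ltW y2) _.
    rewrite ler_pM2l// lef_pV2 ?posrE ?exprn_gt0//.
    by rewrite exprS ler_peMl ?exprn_ge0// ler1n.
  exists l; move/closed2P_dist : cG; apply => e e0.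
  have c1 : 0 <= 2 * (c * 2) + 1 by rewrite addr_ge0// !mulr_ge0.
  have [n ne] := pow2_small c1 e0; exists (g n).1, (g n).2.
  have [G1 y1] := Hg n; split => //.
    apply: le_lt_trans (Hl n) _; apply: le_lt_trans ne.
    by rewrite ler_pM2r ?invr_gt0 ?exprn_gt0// lerDl.
  apply: lt_le_trans y1 _; apply: le_trans (ltW ne).
  by rewrite ler_pM2r ?invr_gt0 ?exprn_gt0// lerDr !mulr_ge0.
(* If all of [Gam] is orthogonal to [h], the term of [h] vanishes; otherwise [(u0, v0)] spans a
   complement of [Gam0] below. *)
have [[[u0 v0] G0 uh0]|G0] :=
  pselect (exists2 p, Gam p & inner p.1 h != 0); last first.
  apply: IH => // u v Guv; have := est _ _ Guv; rewrite big_cons.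
  have [->|uh] := eqVneq (inner u h) 0; first by rewrite normr0 add0r.
  by exfalso; apply: G0; exists (u, v).
pose Gam0 : set (U * V) := [set p | Gam p /\ inner p.1 h = 0].
have sG0 : subspace_set Gam0.
  split; first by split; [exact: sG.1|exact: inner0l].
  move=> a p q [Gp ph] [Gq qh]; split; first exact: sG.2.
  by rewrite /= innerDl innerZl ph qh mulr0 addr0.
have cG0 : closed Gam0.
  apply/closed2P_dist => x y Hxy; split.
    move/closed2P_dist : cG; apply => e e0.
    by have [u [v [[? _] ? ?]]] := Hxy _ e0; exists u, v.
  apply: inner_eq0_small => e e0.
  by have [u [v [[_ ?] ? ?]]] := Hxy _ e0; exists u.
have cW0 : closed [set v | exists u, Gam0 (u, v)].
  apply: IH => // u v [/est + /= uh]; by rewrite big_cons uh normr0 add0r.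
have sW0 : subspace_set [set v | exists u, Gam0 (u, v)].
  split; first by exists 0; exact: sG0.1.
  move=> a v1 v2 [u1 G1] [u2 G2]; exists (a *: u1 + u2).
  exact: (sG0.2 a _ _ G1 G2).
suff -> : [set v | exists u, Gam (u, v)] =
    [set x | exists a, [set v | exists u, Gam0 (u, v)] (x - a *: v0)].
  exact: closed_add_line.
apply/seteqP; split => v /=.
  move=> [u Guv]; exists (inner u h / inner u0 h).
  exists (u - (inner u h / inner u0 h) *: u0); split => /=.
      exact: (subspaceB sG Guv (subspaceZ sG (inner u h / inner u0 h) G0)).
  by rewrite innerBl innerZl divfK// subrr.
move=> [a [u [Guv _]]]; exists (u + a *: u0).
have : Gam (u + a *: u0, v - a *: v0 + a *: v0).
  exact: (subspaceD sG Guv (subspaceZ sG a G0)).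
by rewrite subrK.
Qed.

Lemma subspace_op_graph (H : hilbertType C) (T : operator H) :
  subspace_set (op_graph T).
Proof. by split; [exact: op_graph0|exact: op_graphP]. Qed.

Lemma subspace_op_ran (H : hilbertType C) (T : operator H) :
  subspace_set (op_ran T).
Proof.
split; first by exists 0; exact: op_graph0.
move=> a y1 y2 [x1 G1] [x2 G2]; exists (a *: x1 + x2).
exact: (op_graphP a G1 G2).
Qed.

Lemma subspace_op_ker (H : hilbertType C) (T : operator H) :
  subspace_set (op_ker T).
Proof.
split; first exact: op_graph0.
move=> a x1 x2 k1 k2; have := op_graphP a k1 k2.
by rewrite /op_ker /=; congr (op_graph T); congr pair; rewrite /= scaler0 addr0.
Qed.

Lemma closed_op_ker (H : hilbertType C) (T : operator H) :
  closed_op T -> closed (op_ker T).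
Proof.
move=> /closed2P_dist cT; apply/closedP_dist => x Hx; apply: cT => e e0.
by have [y ky xy] := Hx _ e0; exists y, 0; rewrite subrr normr0.
Qed.

(** On the kernel the estimate says that a vector orthogonal to all of [s] is zero, which bounds the
    dimension. *)
Lemma F_plus_estimate (H : hilbertType C) (T : operator H) (s : seq H) (c : C) :
  0 <= c -> closed_op T ->
  (forall x y, op_graph T (x, y) ->
    `|x| <= c * (`|y| + \sum_(h <- s) `|inner x h|)) -> F_plus T.
Proof.
move=> c0 cT est; split => //.
  exact: closed_range_estimate c0 (subspace_op_graph T) cT est.
apply: (@fin_dim_separated _ _ _ s (subspace_op_ker T)) => x kx xs.
have := est _ _ kx; rewrite normr0 add0r big_seq big1 ?mulr0.
  by rewrite normr_le0 => /eqP.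
by move=> h hs; rewrite xs// normr0.
Qed.

End ClosedRange.

(** * Parts of bounded operators *)

Section PartOperators.
Variable R : realType.
Local Notation C := R[i].

Lemma bounded_opP (V W : normedModType C) (f : {linear V -> W}) (c : C) :
  0 <= c -> (forall x, `|f x| <= c * `|x|) -> bounded_op f.
Proof.
move=> c0 fc; apply/linear_boundedP; near=> r => x.
apply: le_trans (fc x) _; rewrite ler_wpM2r//.
near: r; apply: nbhs_pinfty_ge; exact: ger0_real.
Unshelve. all: by end_near. Qed.

Lemma emb_bounded (V W : normedModType C) (i : embedding V W) : bounded_op i.
Proof. exact/linear_bounded_continuous/emb_continuous. Qed.

Lemma bounded_comp (U V W : normedModType C) (f : {linear V -> W})
  (g : {linear U -> V}) : bounded_op f -> bounded_op g -> bounded_op (f \o g).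
Proof.
move=> /bounded_op_bound[c c0 fc] /bounded_op_bound[d d0 gd].
apply: (@bounded_opP _ _ _ (c * d)) => [|x]; first by rewrite mulr_ge0 ?ltW.
by apply: le_trans (fc _) _; rewrite -mulrA ler_pM2l.
Qed.

Lemma bounded_add (V W : normedModType C) (f g : {linear V -> W}) :
  bounded_op f -> bounded_op g -> bounded_op (f \+ g).
Proof.
move=> /bounded_op_bound[c c0 fc] /bounded_op_bound[d d0 gd].
apply: (@bounded_opP _ _ _ (c + d)) => [|x]; first by rewrite addr_ge0 ?ltW.
by apply: le_trans (ler_normD _ _) _; rewrite mulrDl lerD.
Qed.

Lemma bounded_sub (V W : normedModType C) (f g : {linear V -> W}) :
  bounded_op f -> bounded_op g -> bounded_op (f \- g).
Proof.
move=> /bounded_op_bound[c c0 fc] /bounded_op_bound[d d0 gd].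
apply: (@bounded_opP _ _ _ (c + d)) => [|x]; first by rewrite addr_ge0 ?ltW.
by apply: le_trans (ler_normB _ _) _; rewrite mulrDl lerD.
Qed.

Lemma bounded_scale (V W : normedModType C) (a : C) (f : {linear V -> W}) :
  bounded_op f -> bounded_op (a \*: f).
Proof.
move=> /bounded_op_bound[c c0 fc].
apply: (@bounded_opP _ _ _ (`|a| * c)) => [|x]; first by rewrite mulr_ge0// ltW.
by rewrite /= normrZ -mulrA ler_wpM2l.
Qed.

Lemma bounded_id (V : normedModType C) : bounded_op (@idfun V : {linear V -> V}).
Proof. by apply: (@bounded_opP _ _ _ 1) => [|x] //; rewrite mul1r. Qed.

Lemma bounded_block (U1 U2 V1 V2 : hilbertType C) (a : {linear U1 -> V1})
    (b : {linear U2 -> V1}) (c : {linear U1 -> V2}) (d : {linear U2 -> V2}) :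
  bounded_op a -> bounded_op b -> bounded_op c -> bounded_op d ->
  bounded_op (block_op a b c d).
Proof.
move=> /bounded_op_bound[ca ca0 Ha] /bounded_op_bound[cb cb0 Hb].
move=> /bounded_op_bound[cc cc0 Hc] /bounded_op_bound[cd cd0 Hd].
apply: (@bounded_opP _ _ _ ((ca + cb) + (cc + cd))) => [|x].
  by rewrite !addr_ge0 ?ltW.
apply: le_trans (hsum_norm_le _) _ => /=; rewrite mulrDl.
have x1 := hsum_norm_fst x; have x2 := hsum_norm_snd x.
apply: lerD; apply: le_trans (ler_normD _ _) _; rewrite mulrDl; apply: lerD.
- by apply: le_trans (Ha _) _; rewrite ler_pM2l.
- by apply: le_trans (Hb _) _; rewrite ler_pM2l.
- by apply: le_trans (Hc _) _; rewrite ler_pM2l.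
- by apply: le_trans (Hd _) _; rewrite ler_pM2l.
Qed.

(** With [g] an embedding this is the graph of the part of [f], a closed relation to which the open
    mapping theorem applies. *)
Lemma closed_equalizer (U V W : normedModType C) (f : {linear U -> W})
    (g : {linear V -> W}) : bounded_op f -> bounded_op g ->
  closed [set p : U * V | f p.1 = g p.2].
Proof.
move=> fb gb; apply/closed2P_dist => x y Hxy /=.
apply/eqP; rewrite -subr_eq0 -normr_eq0 eq_le normr_ge0 andbT.
apply: ge0_ler_addgt0 => // e e0; rewrite add0r.
have e2 : 0 < e / 2 by rewrite divr_gt0.
have [d1 d10 H1] := bounded_op_dist x fb e2.
have [d2 d20 H2] := bounded_op_dist y gb e2.
have cmp : d1 >=< d2 by rewrite real_comparable// gtr0_real.
have [|u [v [/= fg xu yv]]] := Hxy (Num.min d1 d2).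
  by rewrite comparable_lt_min// d10.
have -> : f x - g y = (f x - f u) - (g y - g v) by rewrite fg opprB addrA subrK.
apply: le_trans (ler_normB _ _) _; rewrite (splitr e) lerD//; apply: ltW.
  by apply: H1; apply: lt_le_trans xu _; rewrite comparable_ge_min// lexx.
by apply: H2; apply: lt_le_trans yv _; rewrite comparable_ge_min// lexx orbT.
Qed.

Lemma subspace_equalizer (U V W : normedModType C) (f : {linear U -> W})
    (g : {linear V -> W}) : subspace_set [set p : U * V | f p.1 = g p.2].
Proof.
split; first by rewrite /= !linear0.
by move=> a p q /= fp fq; rewrite !linearP fp fq.
Qed.

Section Part.
Variables (U V H : hilbertType C) (i : embedding U H) (j : embedding H V).
Variables (M : {linear U -> V}) (lam : C).
Hypothesis Mb : bounded_op M.
Let T := shift_op (part_op i j M) lam.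

Let eqn : {linear U -> V} := M \- (lam \*: (j \o i)).

Let eqnb : bounded_op eqn.
Proof.
apply: bounded_sub => //; apply: bounded_scale.
by apply: bounded_comp; exact: emb_bounded.
Qed.

Lemma shift_partP x y :
  op_graph T (x, y) <-> exists2 u, i u = x & M u = j y + lam *: j x.
Proof.
split; move=> [u /= iu Mu]; exists u => //.
  by rewrite Mu linearD linearZ.
by rewrite /= Mu linearD linearZ.
Qed.

Let eqnP u y : eqn u = j y <-> M u = j y + lam *: j (i u).
Proof.
by rewrite /eqn /=; split => [<-|->]; rewrite ?subrK ?addrK.
Qed.

(** Bijectivity suffices: the open mapping theorem for the closed relation [eqn u = j y], whose
    range is all of [H], bounds the inverse. *)
Lemma resolvent_part :
  (forall y, exists u, M u = j y + lam *: j (i u)) ->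
  (forall u, M u = lam *: j (i u) -> u = 0) ->
  resolvent_set (part_op i j M) lam.
Proof.
move=> surj inj.
have uniq u u' y : eqn u = j y -> eqn u' = j y -> u = u'.
  move=> e1 e2; apply/eqP; rewrite -subr_eq0; apply/eqP/inj.
  have /eqnP : eqn (u - u') = j 0 by rewrite linearB e1 e2 subrr linear0.
  by rewrite linear0 add0r.
have ex y : exists u, eqn u = j y by have [u /eqnP] := surj y; exists u.
have [X HX] := choice ex.
have Xlin : linear (i \o X).
  move=> a y y' /=; rewrite -linearP; congr (i _).
  apply: (uniq _ _ (a *: y + y')); first exact: HX.
  by rewrite [LHS]linearP !HX linearP.
pose iX : {linear H -> H} := HB.pack (i \o X) (GRing.isLinear.Build _ _ _ _ _ Xlin).
have [c1 c10 Hi] := bounded_op_bound (emb_bounded i).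
have [|c c0 Hc] := open_mapping_relation (subspace_equalizer eqn j)
    (closed_equalizer eqnb (emb_bounded j)).
  rewrite (_ : [set v | _] = setT); first exact: closedT.
  by apply/seteqP; split => // y _; have [u] := ex y; exists u.
exists iX.
  apply: (@bounded_opP _ _ _ (c1 * c)) => [|y]; first by rewrite mulr_ge0// ltW.
  have [u /= eu uc] := Hc y (ex y).
  rewrite /= -(uniq _ _ _ eu (HX y)); apply: le_trans (Hi _) _.
  by rewrite -mulrA ler_pM2l.
move=> x y; split.
  move=> /shift_partP[u <-] /eqnP Mu /=; congr (i _); exact: uniq (HX y) Mu.
move=> /= <-; apply/shift_partP; exists (X y) => //.
exact/eqnP/HX.
Qed.

(** The estimate is in the stronger norm of [U]. Hence preimages along a convergent sequence of
    graph points are Cauchy in [U], which yields the closedness needed in [F_plus_estimate]. *)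
Lemma F_plus_part (s : seq H) (c : C) : 0 <= c ->
  (forall u y, M u = j y + lam *: j (i u) ->
     `|u| <= c * (`|y| + \sum_(h <- s) `|inner (i u) h|)) -> F_plus T.
Proof.
move=> c0 est; have [c1 c10 Hi] := bounded_op_bound (emb_bounded i).
apply: (@F_plus_estimate _ _ T s (c1 * c)); first by rewrite mulr_ge0// ltW.
  apply/closed2P_dist => X Y HXY.
  have pw n : 0 < (1 / 2 ^+ n : C) by rewrite divr_gt0// exprn_gt0.
  have step n : exists p : U * H, [/\ eqn p.1 = j p.2, `|X - i p.1| < 1 / 2 ^+ n &
      `|Y - p.2| < 1 / 2 ^+ n].
    have [x [y [/shift_partP[u <- /eqnP Mu] Xx Yy]]] := HXY _ (pw n).
    by exists (u, y).
  have [g Hg] := choice step.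
  have ns0 : 0 <= \sum_(h <- s) `|h| by rewrite sumr_ge0.
  have pwS n : (1 / 2 ^+ n.+1 : C) <= 1 / 2 ^+ n.
    rewrite ler_pM2l// lef_pV2 ?posrE ?exprn_gt0//.
    by rewrite exprS ler_peMl ?exprn_ge0// ler1n.
  have diff (Z a b : H) n : `|Z - a| < 1 / 2 ^+ n -> `|Z - b| < 1 / 2 ^+ n.+1 ->
      `|b - a| <= 2 / 2 ^+ n.
    move=> Za Zb; have -> : b - a = (Z - a) - (Z - b).
      by rewrite opprB [RHS]addrC addrA subrK.
    apply: le_trans (ler_normB _ _) _; rewrite -[2]/(1 + 1) mulrDl lerD ?(ltW Za)//.
    exact: le_trans (ltW Zb) (pwS n).
  (* Both components of consecutive graph points differ by at most [2 / 2 ^+ n]; Cauchy-Schwarz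
     turns the inner products into norms of the [h]. *)
  pose k := 2 * (c * (1 + \sum_(h <- s) `|h|)).
  have k0 : 0 <= k by rewrite !mulr_ge0// addr_ge0.
  have [||u Hu] := @geometric_cvg R U (fun n => (g n).1) k => //.
    move=> n; have [G1 x1 y1] := Hg n; have [G2 x2 y2] := Hg n.+1.
    have /eqnP/est : eqn ((g n.+1).1 - (g n).1) = j ((g n.+1).2 - (g n).2).
      by rewrite [LHS]linearB G1 G2 linearB.
    move/le_trans; apply.
    rewrite /k mulrAC [in leRHS]mulrC -mulrA ler_wpM2l// mulrDl mul1r.
    rewrite lerD ?(diff _ _ _ _ y1 y2)// mulr_suml; apply: ler_sum => h _.
    apply: le_trans (cauchy_schwarz _ _) _; rewrite [leLHS]mulrC ler_wpM2l//.
    by rewrite linearB; exact: diff x1 x2.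
  have small (e : C) : 0 < e -> exists n, 2 * k / 2 ^+ n < e /\ 1 / 2 ^+ n < e.
    move=> e0; have k1 : 0 <= 2 * k + 1 by rewrite addr_ge0// mulr_ge0.
    have [n ne] := pow2_small k1 e0; exists n.
    by split; apply: le_lt_trans ne; rewrite ler_pM2r ?invr_gt0 ?exprn_gt0//
      ?lerDl ?lerDr// mulr_ge0.
  have XE : i u = X.
    move/closed2P_dist : (closed_equalizer (emb_bounded i) (bounded_id H)).
    apply=> e /small[n [kn wn]]; exists (g n).1, (i (g n).1); have [_ Xn _] := Hg n.
    by split => //; [exact: le_lt_trans kn|exact: lt_trans wn].
  apply/shift_partP; exists u; rewrite -?XE//; apply/eqnP.
  move/closed2P_dist : (closed_equalizer eqnb (emb_bounded j)).
  apply=> e /small[n [kn wn]]; exists (g n).1, (g n).2; have [Gn _ Yn] := Hg n.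
  by split => //; [exact: le_lt_trans kn|exact: lt_trans wn].
move=> _ y /shift_partP[u <- Mu]; apply: le_trans (Hi _) _.
by rewrite -mulrA ler_pM2l//; exact: est.
Qed.

End Part.
End PartOperators.

(** * Extensions of an operator and of its generalised inverse *)

Section ExtendedPart.
Variable R : realType.
Local Notation C := R[i].
Variables (U V W H : hilbertType C).
Variables (i : embedding U H) (j : embedding H V) (k : embedding V W).
Variables (S : {linear U -> V}) (T : {linear U -> W}).
Hypotheses (Sb : bounded_op S) (kS : forall f, k (S f) = T f).
Hypothesis jd : dense_range j.
Let T0 := part_op i (comp_emb k j) T.

Lemma shift_part_compP z x y : op_graph (shift_op T0 z) (x, y) <->
  exists2 f, i f = x & S f = j y + z *: j x.
Proof.
split=> [/shift_partP|] [f fx Hf]; exists f => //.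
  by apply: (@emb_inj _ _ _ k); rewrite kS Hf linearD linearZ.
by rewrite /= -kS Hf -linearZ -linearD linearD linearZ.
Qed.

(** The range is closed with trivial cokernel, so the generalised inverse is a right inverse on [H];
    both sides are bounded in [x] and agree on the dense range of [j]. *)
Lemma extended_right_inverse z (E : {linear V -> U}) : bounded_op E ->
  closed (op_ran (shift_op T0 z)) -> op_coker (shift_op T0 z) = [set 0] ->
  extends_gen_inverse i j (shift_op T0 z) E ->
  forall x, S (E x) = x + z *: j (i (E x)).
Proof.
move=> Eb cR cok [Y [_ _ _ Yran _] EY].
have ranT := closed_orthocomp0 (@subspace_op_ran _ _ _) cR cok.
pose f : {linear V -> V} := S \o E.
pose g : {linear V -> V} := idfun \+ (z \*: (j \o i \o E)).
suff : f =1 g by [].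
apply: (@dense_linear_eq _ _ _ _ _ (range j)) => //.
- exact: bounded_comp.
- apply: bounded_add; first exact: bounded_id.
  apply: bounded_scale; apply: bounded_comp => //.
  by apply: bounded_comp; exact: emb_bounded.
move=> _ /set_mem[h _ <-].
have [|_ /shift_part_compP[u iu Su]] := Yran h; first by rewrite ranT.
have -> : f (j h) = S u.
  by rewrite /f /=; congr (S _); apply: (@emb_inj _ _ _ i); rewrite EY.
by rewrite Su /g /= EY.
Qed.

(* [x] is in [ran S] iff [z E x] is in [ran T0]. *)
Lemma closed_range_extension z (E : {linear V -> U}) : bounded_op E ->
  (forall x, S (E x) = x + z *: j (i (E x))) ->
  closed (op_ran (shift_op T0 0)) -> closed (range S).
Proof.
move=> Eb SE /closedP_dist cR; apply/closedP_dist => x Hx.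
pose h : {linear V -> H} := z \*: (i \o E).
have hb : bounded_op h.
  by apply: bounded_scale; apply: bounded_comp => //; exact: emb_bounded.
(* Hence [y] differs from an element of [ran S] by the embedded vector [h y], so questions about
   [ran S] in [V] become questions in [H]. *)
have jh y : j (h y) = S (E y) - y by rewrite SE addrC addKr /h /= linearZ.
have [u /shift_part_compP[f _ Sf]] : op_ran (shift_op T0 0) (h x).
  apply: cR => e e0; have [d d0 Hd] := bounded_op_dist x hb e0.
  have [_ [f _ <-] xf] := Hx _ d0; exists (h (S f)); last exact: Hd.
  exists (i (E (S f) - f)); apply/shift_part_compP; exists (E (S f) - f) => //.
  by rewrite scale0r addr0 jh linearB.
exists (E x - f) => //.
by rewrite linearB Sf scale0r addr0 jh subKr.
Qed.

(** The open mapping theorem gives an [f0] controlled by [S f] with [S f0 = S f]; the difference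
    lies in the kernel and is determined by its inner products with a frame. *)
Lemma semi_fredholm_estimate : closed (range S) ->
  fin_dim (op_ker (shift_op T0 0)) ->
  exists s c, 0 <= c /\
    forall f, `|f| <= c * (`|S f| + \sum_(h <- s) `|inner (i f) h|).
Proof.
move=> cR fd; have [s [sE Hs]] := fin_dim_frame (@subspace_op_ker _ _ _) fd.
have [c1 c10 Hi] := bounded_op_bound (emb_bounded i).
have [|c c0 Hc] := open_mapping_relation (subspace_equalizer S idfun)
    (closed_equalizer Sb (bounded_id V)).
  rewrite (_ : [set v | _] = range S)//.
  by apply/seteqP; split => [v [u /= <-]|_ [u _ <-]]; exists u.
(* Frame vectors are lifted to [U], so that the expansion holds in the norm of [U]; outside the
   kernel the value 0 is a dummy. *)
have pre (e : H) : exists u, op_ker (shift_op T0 0) e -> i u = e.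
  have [[u /= <- _]|ne] := pselect (exists2 f, i f = e & S f = 0); first by exists u.
  exists 0 => /shift_part_compP[f fe Sf]; exfalso; apply: ne; exists f => //.
  by rewrite Sf linear0 scale0r addr0.
have [eps Heps] := choice pre.
pose m := \sum_(e <- s) `|eps e|; pose M := \sum_(e <- s) `|e| * `|eps e|.
have m0 : 0 <= m by rewrite sumr_ge0.
have M0 : 0 <= M by rewrite sumr_ge0// => e _; rewrite mulr_ge0.
(* The summands come from [f0], from the inner products of [f0] with the frame, and from the lifted
   frame vectors. *)
exists s, (c + c1 * c * M + m); split; first by rewrite !addr_ge0 ?mulr_ge0// ltW.
move=> f; have [|f0 /= Sf0 f0c] := Hc (S f); first by exists f.
have kf : op_ker (shift_op T0 0) (i (f - f0)).
  apply/shift_part_compP; exists (f - f0) => //.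
  by rewrite linearB Sf0 subrr linear0 scale0r addr0.
have fE : f - f0 = \sum_(e <- s) inner (i (f - f0)) e *: eps e.
  apply: (@emb_inj _ _ _ i); rewrite {1}(Hs _ kf) linear_sum big_seq [RHS]big_seq.
  by apply: eq_bigr => e es; rewrite linearZ/= Heps//; exact: sE.
set Z := \sum_(h <- s) _; have Z0 : 0 <= Z by rewrite sumr_ge0.
have -> : f = f0 + (f - f0) by rewrite addrC subrK.
rewrite {1}fE; apply: le_trans (ler_normD _ _) _.
have step1 : `|\sum_(e <- s) inner (i (f - f0)) e *: eps e| <=
    \sum_(e <- s) (`|inner (i f) e| * m + c1 * c * `|S f| * (`|e| * `|eps e|)).
  apply: le_trans (ler_norm_sum _ _ _) _.
  rewrite big_seq [leRHS]big_seq; apply: ler_sum => e es.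
  rewrite normrZ linearB innerBl.
  apply: le_trans (ler_wpM2r _ (ler_normB _ _)) _ => //.
  rewrite mulrDl lerD//.
    by rewrite ler_wpM2l// /m (big_rem e)//= lerDl sumr_ge0.
  rewrite mulrA ler_wpM2r//; apply: le_trans (cauchy_schwarz _ _) _.
  by rewrite ler_wpM2r//; apply: le_trans (Hi _) _; rewrite -mulrA ler_pM2l.
apply: le_trans (lerD f0c step1) _.
rewrite big_split/= -mulr_suml -mulr_sumr -/Z -/M (addrC f0) subrK.
rewrite -subr_ge0.
have -> : (c + c1 * c * M + m) * (`|S f| + Z) -
    (c * `|S f| + (Z * m + c1 * c * `|S f| * M)) =
  c * Z + c1 * c * M * Z + m * `|S f| by ring.
by rewrite !addr_ge0 ?mulr_ge0// ltW.
Qed.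

End ExtendedPart.

(** * The extended generalised inverse of [D0 - lambda] *)

Section GeneralisedInverse.
Variable R : realType.
Local Notation C := R[i].
Variables (U V H : hilbertType C).
Variables (i : embedding U H) (j : embedding H V) (D : {linear U -> V}).
Variables (D0 : operator H) (lam : C) (E : {linear V -> U}).
Hypotheses (D0_dense : dense (i @^-1` op_dom D0)) (D_bounded : bounded_op D).
Hypothesis D_extends : forall g y, op_graph D0 (i g, y) -> D g = j y.
Hypothesis E_bounded : bounded_op E.
Let T := shift_op D0 lam.
Hypothesis E_extends : extends_gen_inverse i j T E.

Let Dl : {linear U -> V} := D \- (lam \*: (j \o i)).

Let Dl_bounded : bounded_op Dl.
Proof.
apply: bounded_sub => //; apply: bounded_scale.
by apply: bounded_comp; exact: emb_bounded.
Qed.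

Let dom_graph g : op_dom D0 (i g) -> exists2 h, op_graph T (i g, h) & Dl g = j h.
Proof.
move=> [y Dy]; exists (y - lam *: i g); first by rewrite /T /= /shift_graph /= subrK.
by rewrite /Dl /= (D_extends Dy) [RHS]linearB [j (_ *: _)]linearZ.
Qed.

(** The generalised inverse kills the component of [y] orthogonal to the range and maps the other
    one into the domain. This makes the assumption on [B] applicable to [E (j y)]. *)
Lemma gen_inverse_dom y : op_dom D0 (i (E (j y))).
Proof.
have [Y [_ cR _ Yran Ycok] EY] := E_extends.
have [w Tw yw] := orthogonal_projection (@subspace_op_ran _ _ _) cR y.
have -> : i (E (j y)) = Y w.
  by rewrite EY -[y](subrK w) linearD Ycok// add0r.
have [_ Tg] := Yran _ Tw; eexists; exact: Tg.
Qed.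

(** For [g] in the domain, [i g] and the generalised inverse of its image under [T] have the same
    image; the kernel is closed, so density extends this to all [g]. *)
Lemma gen_inverse_ker_cond : closed_op T ->
  forall g, op_ker T (i (g - E (D g - lam *: j (i g)))).
Proof.
move=> cT; have [Y [_ _ _ Yran _] EY] := E_extends.
pose K : {linear U -> H} := i \o (idfun \- (E \o Dl)).
change (forall g, op_ker T (K g)).
apply: dense_closed_preimage D0_dense (closed_op_ker cT) _.
  apply: bounded_comp; first exact: emb_bounded.
  by apply: bounded_sub; [exact: bounded_id|exact: bounded_comp].
move=> g /dom_graph[h Tg Dh]; have [|_ TY] := Yran h; first by exists (i g).
have GT := subspaceB (subspace_op_graph T) Tg TY.
have -> : K g = i g - Y h.
  have -> : K g = i (g - E (Dl g)) by [].
  by rewrite Dh linearB EY.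
rewrite /op_ker /mkset -(subrr h); exact: GT.
Qed.

(** The generalised inverse takes values orthogonal to the kernel, and density extends this. Hence
    subtracting [E (D - lambda) g] from [g] leaves inner products with kernel vectors unchanged. *)
Lemma gen_inverse_orth x : op_ker T x ->
  forall g, inner (i (E (D g - lam *: j (i g)))) x = 0.
Proof.
move=> Tx; have [Y [_ _ _ Yran _] EY] := E_extends.
pose K : {linear U -> H} := i \o (E \o Dl).
change (forall g, [set y | inner y x = 0] (K g)).
apply: dense_closed_preimage D0_dense _ _.
- by apply: bounded_comp; [exact: emb_bounded|exact: bounded_comp].
- by apply/closedP_dist => y Hy; exact: inner_eq0_small.
move=> g /dom_graph[h Tg Dh]; have [|Yk _] := Yran h; first by exists (i g).
have -> : K g = i (E (Dl g)) by [].
by rewrite Dh EY; exact: Yk.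
Qed.

Lemma gen_inverse_right : dense_range j -> op_ran T = setT ->
  forall x, D (E x) = x + lam *: j (i (E x)).
Proof.
move=> jd ranT x; have [Y [_ _ _ Yran _] EY] := E_extends.
pose f : {linear V -> V} := Dl \o E.
have : f x = (@idfun V : {linear V -> V}) x.
  apply: (@dense_linear_eq _ _ _ _ _ (range j)) => //.
  - exact: bounded_comp.
  - exact: bounded_id.
  move=> _ /set_mem[h _ <-]; have [|_ TY] := Yran h; first by rewrite ranT.
  rewrite /f /Dl /= EY (D_extends (y := h + lam *: Y h)).
    by rewrite linearD linearZ addrK.
  by rewrite EY.
by rewrite /f /Dl /= => /eqP; rewrite subr_eq => /eqP.
Qed.

End GeneralisedInverse.

(** * The operator matrix *)

Section MatrixReduction.
Variable R : realType.
Variables (H1 H2 DS D2 DmS Dm1 Dm2 : hilbertType R[i]).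
Variables (iS : embedding DS H1) (jS : embedding H1 DmS) (kS : embedding DmS Dm1).
Variables (i2 : embedding D2 H2) (j2 : embedding H2 Dm2).
Variables (A : {linear DS -> Dm1}) (B : {linear D2 -> Dm1}) (C : {linear DS -> Dm2}).
Variables (D0 : operator H2) (D : {linear D2 -> Dm2}).
Variables (lam : R[i]) (Ddag : R[i] -> {linear Dm2 -> D2}) (S : {linear DS -> DmS}).
Hypotheses (j2_dense : dense_range j2).
Hypotheses (A_bounded : bounded_op A) (B_bounded : bounded_op B).
Hypotheses (C_bounded : bounded_op C) (D_bounded : bounded_op D).
Hypotheses (D0_dom : op_dom D0 `<=` range i2).
Hypothesis D0_dense : dense (i2 @^-1` op_dom D0).
Hypothesis D_extends : forall g y, op_graph D0 (i2 g, y) -> D g = j2 y.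
Hypothesis Ddag_bounded : bounded_op (Ddag lam).
Hypothesis Ddag_extends :
  extends_gen_inverse i2 j2 (shift_op D0 lam) (Ddag lam).
Hypothesis kS_S : forall f, kS (S f) = schur iS jS kS A B C Ddag lam f.
Hypothesis B_dom : B @` (i2 @^-1` op_dom D0) `<=` range kS.

Let E := Ddag lam.
Let T := shift_op D0 lam.
(** Seen in [H2], this is the orthogonal projection onto the kernel of [D0 - lambda]. *)
Let K (g : D2) : D2 := g - E (D g - lam *: j2 (i2 g)).

Let T_closed : closed_op T.
Proof. by have [Y []] := Ddag_extends. Qed.

(** Closed graph theorem: [B E j2] has its values in the range of [kS] and is bounded into [Dm1], so
    it is bounded into [DmS]. *)
Lemma coupling_bounded : exists2 c, 0 < c &
  forall y, exists2 d, kS d = B (E (j2 y)) & `|d| <= c * `|y|.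
Proof.
pose h : {linear H2 -> Dm1} := B \o E \o j2.
have hb : bounded_op h.
  by apply: bounded_comp; [exact: bounded_comp|exact: emb_bounded].
have ex y : exists d, kS d = h y.
  have [d _ dE] : range kS (h y); last by exists d.
  by apply: B_dom; exists (E (j2 y)) => //; exact: (gen_inverse_dom Ddag_extends).
have [|c c0 Hc] := open_mapping_relation (subspace_equalizer kS h)
    (closed_equalizer (emb_bounded kS) hb).
  rewrite (_ : [set v | _] = setT); first exact: closedT.
  by apply/seteqP; split => // y _; have [u] := ex y; exists u.
by exists c => // y; have [d dE dc] := Hc y (ex y); exists d.
Qed.

Lemma matrix_eqP u v :
  block_op A B C D u = hsum_emb (comp_emb kS jS) j2 v +
    lam *: hsum_emb (comp_emb kS jS) j2 (hsum_emb iS i2 u) <->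
  A u.1 + B u.2 = kS (jS v.1) + lam *: kS (jS (iS u.1)) /\
  C u.1 + D u.2 = j2 v.2 + lam *: j2 (i2 u.2).
Proof.
rewrite /= /block_op /= !addr0 !add0r.
by split=> [[-> ->]//|[-> ->]].
Qed.

(** Applying [E] to the second row expresses [g] through [K g], [y] and [f]; inserting this into the
    first row leaves the Schur complement. Here [d] and [q] represent [B E y] and [B K g] in
    [DmS]. *)
Lemma schur_elimination f g x y d q :
  A f + B g = kS (jS x) + lam *: kS (jS (iS f)) ->
  C f + D g = j2 y + lam *: j2 (i2 g) ->
  kS d = B (E (j2 y)) -> kS q = B (K g) ->
  S f = jS x - d - q /\ g = K g + E (j2 y) - E (C f).
Proof.
move=> eq1 eq2 dE qE.
have DgE : D g - lam *: j2 (i2 g) = j2 y - C f.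
  apply/eqP; rewrite subr_eq addrAC -eq2.
  by rewrite addrAC subrr add0r.
have KE : K g = g - E (j2 y) + E (C f).
  by rewrite /K DgE linearB opprB addrA addrAC.
split; last by rewrite KE addrAC addrK subrK.
apply: (@emb_inj _ _ _ kS); rewrite kS_S !linearB dE qE KE /schur /= linearD linearB.
have -> : A f = kS (jS x) + lam *: kS (jS (iS f)) - B g by rewrite -eq1 addrK.
rewrite -/E opprD opprB [in RHS]addrA; congr (_ - _).
by rewrite [RHS]addrA subrK addrAC addrK.
Qed.

Lemma kernel_part g : op_ker T (i2 (K g)).
Proof.
exact: (gen_inverse_ker_cond D0_dense D_bounded D_extends Ddag_bounded
  Ddag_extends T_closed).
Qed.

Lemma op_ker_dom x : op_ker T x -> op_dom D0 x.
Proof. by move=> kx; eexists; exact: kx. Qed.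

Lemma matrix_resolvent z (ES : {linear DmS -> DS}) :
  bounded_op ES -> (forall x, S (ES x) = x + z *: jS (iS (ES x))) ->
  resolvent_set D0 lam -> resolvent_set (schur0 iS jS kS A B C Ddag lam) 0 ->
  resolvent_set (matrix_op0 iS jS kS i2 j2 A B C D) lam.
Proof.
move=> ESb SES [X Xb HX] [X0 X0b HX0].
have shiftP := @shift_part_compP _ _ _ _ _ iS jS kS S _ kS_S.
(* [S] maps [ES x] to [x] plus an embedded vector of [H1], and that surplus is in the range of
   [S0]. *)
have Ssurj x : exists f, S f = x.
  have /HX0/shiftP[f _ Sf] := erefl (X0 (z *: iS (ES x))).
  exists (ES x - f); rewrite linearB SES Sf scale0r addr0 linearZ.
  by rewrite addrK.
have Sinj f : S f = 0 -> f = 0.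
  move=> Sf; apply: (@emb_inj _ _ _ iS); rewrite linear0.
  have /HX0 <- : op_graph (shift_op (schur0 iS jS kS A B C Ddag lam) 0) (iS f, 0).
    by apply/shiftP; exists f => //; rewrite linear0 scale0r addr0.
  by rewrite linear0.
have K0 g : K g = 0.
  by apply: (@emb_inj _ _ _ i2); have /HX <- := kernel_part g; rewrite !linear0.
have ranT : op_ran T = setT.
  by apply/seteqP; split => // y _; exists (X y); exact/HX.
have DE := gen_inverse_right D_bounded D_extends Ddag_bounded Ddag_extends
  j2_dense ranT.
have [c _ Hc] := coupling_bounded.
apply: resolvent_part => [|[x y]|[f g]].
- exact: bounded_block.
- have [d dE _] := Hc y; have [f Sf] := Ssurj (jS x - d).
  (* Back substitution: [f] solves the Schur complement equation and [g] comes from the second row,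
     where [E] is now a right inverse. *)
  exists (f, E (j2 y - C f)); apply/matrix_eqP => /=; split; last first.
    by rewrite DE addrA [C f + _]addrC subrK.
  have -> : A f = kS (jS x) - B (E (j2 y)) + B (E (C f)) + lam *: kS (jS (iS f)).
    by rewrite -dE -linearB -Sf kS_S /schur /= !subrK.
  rewrite linearB linearB addrAC; congr (_ + _).
  by rewrite -addrA [B (E (C f)) + _]addrC subrK subrK.
- move=> Mu; have /matrix_eqP[/= e1 e2] : block_op A B C D (f, g) =
      hsum_emb (comp_emb kS jS) j2 0 +
      lam *: hsum_emb (comp_emb kS jS) j2 (hsum_emb iS i2 (f, g)).
    by rewrite Mu linear0 add0r.
  have [|| Sf gE] := schur_elimination (d := 0) (q := 0) e1 e2.
  + by rewrite !linear0.
  + by rewrite K0 !linear0.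
  have f0 : f = 0 by apply: Sinj; rewrite Sf linear0 !subr0.
  by rewrite gE K0 f0 !linear0 !addr0.
Qed.

Lemma matrix_F_plus z (ES : {linear DmS -> DS}) : bounded_op S ->
  bounded_op ES -> (forall x, S (ES x) = x + z *: jS (iS (ES x))) ->
  F_plus T -> F_plus (shift_op (schur0 iS jS kS A B C Ddag lam) 0) ->
  F_plus (shift_op (matrix_op0 iS jS kS i2 j2 A B C D) lam).
Proof.
move=> Sb ESb SES [_ _ kerT] [_ ranS0 kerS0].
have ranS := closed_range_extension kS_S ESb SES ranS0.
have [s1 [c1 [c10 est1]]] := semi_fredholm_estimate Sb kS_S ranS kerS0.
have [s2 [s2E Hs2]] := fin_dim_frame (@subspace_op_ker _ _ _) kerT.
have [cb cb0 Hcb] := coupling_bounded.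
(* Each kernel vector is lifted to [D2] and its image under [B] to [DmS]; [(0, 0)] is a dummy
   elsewhere. *)
have pre (e : H2) : exists p : D2 * DmS,
    op_ker T e -> i2 p.1 = e /\ kS p.2 = B p.1.
  have [/[dup] ke /op_ker_dom/[dup] de /D0_dom[u _ ue]|] := pselect (op_ker T e);
    last by exists (0, 0).
  have [b _ bE] : range kS (B u) by apply: B_dom; exists u => //; rewrite /= ue.
  by exists (u, b).
have [p Hp] := choice pre.
have KE g : K g = \sum_(e <- s2) inner (i2 g) e *: (p e).1.
  apply: (@emb_inj _ _ _ i2); rewrite {1}(Hs2 _ (kernel_part g)) linear_sum.
  rewrite big_seq [RHS]big_seq; apply: eq_bigr => e es.
  have ke := s2E _ es; have [pe _] := Hp _ ke; rewrite linearZ/= pe; congr (_ *: _).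
  rewrite /K linearB innerBl.
  by rewrite (gen_inverse_orth D0_dense D_bounded D_extends Ddag_bounded
    Ddag_extends ke) subr0.
pose Q g := \sum_(e <- s2) inner (i2 g) e *: (p e).2.
have QE g : kS (Q g) = B (K g).
  rewrite KE !linear_sum big_seq [RHS]big_seq; apply: eq_bigr => e es.
  by have [_ pe] := Hp _ (s2E _ es); rewrite !linearZ/= pe.
pose m := \sum_(e <- s2) (`|(p e).1| + `|(p e).2|).
have m0 : 0 <= m by rewrite sumr_ge0// => e _; rewrite addr_ge0.
pose Z g : R[i] := \sum_(e <- s2) `|inner (i2 g) e|.
have Z0 g : 0 <= Z g by rewrite sumr_ge0.
have mle e : e \in s2 -> `|(p e).1| <= m /\ `|(p e).2| <= m.
  move=> es; rewrite /m (big_rem e)//=.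
  have r0 : 0 <= \sum_(y <- rem e s2) (`|(p y).1| + `|(p y).2|).
    by rewrite sumr_ge0// => i _; rewrite addr_ge0.
  by rewrite -addrA; split; [rewrite lerDl addr_ge0|rewrite addrCA lerDl addr_ge0].
have Kle g : `|K g| <= m * Z g.
  rewrite KE mulr_sumr; apply: le_trans (ler_norm_sum _ _ _) _.
  rewrite big_seq [leRHS]big_seq; apply: ler_sum => e es.
  by rewrite normrZ mulrC ler_wpM2r//; case: (mle _ es).
have Qle g : `|Q g| <= m * Z g.
  rewrite mulr_sumr; apply: le_trans (ler_norm_sum _ _ _) _.
  rewrite big_seq [leRHS]big_seq; apply: ler_sum => e es.
  by rewrite normrZ mulrC ler_wpM2r//; case: (mle _ es).
have [cj cj0 Hj] := bounded_op_bound (emb_bounded jS).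
have [cE cE0 HE] := bounded_op_bound (bounded_comp Ddag_bounded (emb_bounded j2)).
have [cC cC0 HC] := bounded_op_bound (bounded_comp Ddag_bounded C_bounded).
(* The frames of both kernels, placed in their summands of [H1] and [H2]. *)
pose s : seq (hsum H1 H2) := [seq (h, 0) | h <- s1] ++ [seq (0, e) | e <- s2].
have sumE u : \sum_(h <- s) `|inner (hsum_emb iS i2 u) h| =
    \sum_(h <- s1) `|inner (iS u.1) h| + Z u.2.
  rewrite /s big_cat !big_map /=; congr (_ + _); apply: eq_bigr => h _.
    by rewrite /inner /= /hsum_inner /= (inner_conj _ 0) inner0l conjC0 !addr0.
  by rewrite /inner /= /hsum_inner /= (inner_conj _ 0) inner0l conjC0 !add0r.
(* [cf] bounds [f] through the three terms of [S f] and the inner products; in [c] below, [m], [cE]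
   and [cC * cf] bound the three terms of [g]. *)
pose cf := c1 * (cj + cb + m + 1); have cf0 : 0 <= cf.
  by rewrite mulr_ge0// !addr_ge0// ltW.
pose c := cf + (m + cE + cC * cf); have c0 : 0 <= c.
  apply: addr_ge0 => //; apply: addr_ge0.
    by apply: addr_ge0 => //; exact: ltW.
  by apply: mulr_ge0 => //; exact: ltW.
apply: (@F_plus_part _ _ _ _ _ _ _ _ _ s c) => //.
  exact: bounded_block.
move=> [f g] [x y] /matrix_eqP[/= eq1 eq2]; rewrite sumE /=.
set N := \sum_(h <- s1) _; have N0 : 0 <= N by rewrite sumr_ge0.
set v := `|((x, y) : hsum H1 H2)|.
have v0 : 0 <= v by exact: normr_ge0.
have xv : `|x| <= v := hsum_norm_fst ((x, y) : hsum H1 H2).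
have yv : `|y| <= v := hsum_norm_snd ((x, y) : hsum H1 H2).
have [d dE dy] := Hcb y.
have [Sf gE] := schur_elimination eq1 eq2 dE (QE g).
pose w := v + (N + Z g).
have w0 : 0 <= w by rewrite !addr_ge0.
have vw : v <= w by rewrite lerDl addr_ge0.
have Zw : Z g <= w by rewrite /w addrA lerDr addr_ge0.
have Nw : N <= w by rewrite /w addrCA lerDl addr_ge0.
have fw : `|f| <= cf * w.
  apply: le_trans (est1 f) _; rewrite /cf -mulrA ler_wpM2l// mulrDl mul1r lerD//.
  rewrite Sf; apply: le_trans (ler_normB _ _) _; rewrite mulrDl lerD//; last first.
    by apply: le_trans (Qle g) _; rewrite ler_wpM2l.
  apply: le_trans (ler_normB _ _) _; rewrite mulrDl lerD//.
    apply: le_trans (Hj _) _; rewrite ler_pM2l//; exact: le_trans xv vw.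
  apply: le_trans dy _; rewrite ler_pM2l//; exact: le_trans yv vw.
have gw : `|g| <= (m + cE + cC * cf) * w.
  rewrite gE; apply: le_trans (ler_normB _ _) _; rewrite mulrDl lerD//; last first.
    by apply: le_trans (HC f) _; rewrite -mulrA ler_pM2l.
  apply: le_trans (ler_normD _ _) _; rewrite mulrDl lerD//.
    by apply: le_trans (Kle g) _; rewrite ler_wpM2l.
  apply: le_trans (HE y) _; rewrite ler_pM2l//; exact: le_trans yv vw.
apply: le_trans (hsum_norm_le _) _; rewrite /c mulrDl.
exact: lerD.
Qed.

End MatrixReduction.

Theorem corollary3p7 (R : realType)
  (H1 H2 DS D2 DmS Dm1 Dm2 : hilbertType R[i])
  (iS : embedding DS H1) (jS : embedding H1 DmS) (kS : embedding DmS Dm1)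
  (i2 : embedding D2 H2) (j2 : embedding H2 Dm2)
  (iS_dense : dense_range iS) (jS_dense : dense_range jS)
  (i2_dense : dense_range i2) (j2_dense : dense_range j2)
  (A : {linear DS -> Dm1}) (B : {linear D2 -> Dm1}) (C : {linear DS -> Dm2})
  (A_bounded : bounded_op A) (B_bounded : bounded_op B)
  (C_bounded : bounded_op C)
  (D0 : operator H2) (D : {linear D2 -> Dm2})
  (D0_closed : closed_op D0)
  (D0_dom : op_dom D0 `<=` range i2) (D0_dense : dense (i2 @^-1` op_dom D0))
  (D_bounded : bounded_op D)
  (D_extends : forall g y, op_graph D0 (i2 g, y) -> D g = j2 y)
  (Theta : set R[i]) (Ddag : R[i] -> {linear Dm2 -> D2})
  (Theta_ran : forall lam, Theta lam -> closed (op_ran (shift_op D0 lam)))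
  (Ddag_bounded : forall lam, Theta lam -> bounded_op (Ddag lam))
  (Ddag_extends : forall lam, Theta lam ->
    extends_gen_inverse i2 j2 (shift_op D0 lam) (Ddag lam)) :
  let A0 := matrix_op0 iS jS kS i2 j2 A B C D in
  let sigma_S0 := schur0_spectrum iS jS kS A B C Theta Ddag in
  let sigma_e2_S0 := schur0_spectrum_e2 iS jS kS A B C Theta Ddag in
  let star := condition_star iS jS kS i2 A B C D0 Ddag in
  (forall Sigma : set R[i], Sigma `<=` Theta ->
    (forall lam, Sigma lam -> star lam /\ resolvent_set D0 lam) ->
    spectrum A0 `&` Sigma `<=` sigma_S0 `&` Sigma) /\
  (forall Sigma : set R[i], Sigma `<=` Theta ->
    (forall lam, Sigma lam -> star lam /\ F_plus (shift_op D0 lam)) ->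
    spectrum_e2 A0 `&` Sigma `<=` sigma_e2_S0 `&` Sigma).
Proof.
move=> A0 sigma_S0 sigma_e2_S0 star; split => Sigma SigmaT HSigma lam [lamA Slam].
- have Tlam := SigmaT _ Slam.
  have [[[S Sb kS_S] _ B_dom [z [cR cok [ES ESb ESE]]]] rho] := HSigma _ Slam.
  have SES := extended_right_inverse Sb kS_S jS_dense ESb cR cok ESE.
  (* By contraposition: if 0 is in the resolvent set of [S0], then [lam] is in that of the matrix.
     The second part argues likewise with [F_plus]. *)
  split => //; split => // rho0; apply: lamA.
  exact: (matrix_resolvent j2_dense A_bounded B_bounded C_bounded D_bounded
    D0_dense D_extends (Ddag_bounded _ Tlam) (Ddag_extends _ Tlam) kS_S B_dom
    ESb SES rho rho0).
- have Tlam := SigmaT _ Slam.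
  have [[[S Sb kS_S] _ B_dom [z [cR cok [ES ESb ESE]]]] FT] := HSigma _ Slam.
  have SES := extended_right_inverse Sb kS_S jS_dense ESb cR cok ESE.
  split => //; split => // FS; apply: lamA.
  exact: (matrix_F_plus A_bounded B_bounded C_bounded D_bounded D0_dom
    D0_dense D_extends (Ddag_bounded _ Tlam) (Ddag_extends _ Tlam) kS_S B_dom
    Sb ESb SES FT FS).
Qed.
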